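(* Consider classical shadow estimation under arbitrary gate-dependent noise: for each Clifford unitary $g$ there is a quantum channel $\Lambda(g)$, the unitary $g$ is drawn uniformly at random from the sampling group, the channel $\omega(g)\Lambda(g)$ is applied to the $n$-qubit state $\rho$, the computational basis is measured with outcome $x$ (probability $\langle x|\omega(g)\Lambda(g)(\rho)|x\rangle$), and the estimator $\hat o(g,x)=(O|S^{-1}\omega(g)^\dagger|E_x)$ is computed, with $S$ the noise-free frame operator. Then: (i) for uniform sampling from the global Clifford group $\mathrm{Cl}_n$, $$\mathbb{V}[\hat o]\le \frac{2(d+1)}{d+2}\lVert O_0\rVert_{\mathrm{st}}^2+\frac{d+1}{d}\lVert O_0\rVert_2^2;$$ (ii) for uniform sampling from the local Clifford group $\mathrm{Cl}_1^{\times n}$, $\mathbb{V}[\hat o]\le 4^k\lVert O_{\mathrm{loc}}\rVert_\infty^2$ for $k$-local observables $O=O_{\mathrm{loc}}\otimes\mathbb 1^{\otimes(n-k)}$ (with $O_{\mathrm{loc}}$ acting on $k$ qubits), and $\mathbb{V}[\hat o]\le 3^{|\mathrm{supp}(\sigma_a)|}$ for Pauli observables $O=\sigma_a$.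
   Context: $d=2^n$; $(A|B)=\mathrm{Tr}(A^\dagger B)$, $|A)(B|$ is the superoperator $C\mapsto(B|C)A$. $\omega(g)(A)=gAg^\dagger$, $\omega(g)^\dagger(A)=g^\dagger Ag$. $E_x=|x\rangle\langle x|$, $M=\sum_{x\in\mathbb{F}_2^n}|E_x)(E_x|$, and the noise-free frame operator is $S=\mathbb{E}_g[\omega(g)^\dagger M\omega(g)]$ with $g$ uniform on the sampling group (global Clifford group $\mathrm{Cl}_n$, or local Clifford group $\mathrm{Cl}_1^{\times n}=\{g_1\otimes\cdots\otimes g_n: g_i\in\mathrm{Cl}_1\}$). $\mathbb V$ denotes variance over the random pair $(g,x)$. $O$ is Hermitian and $O_0=O-\mathrm{Tr}(O)\mathbb 1/d$ its traceless part. Pauli operators $\sigma_a=\sigma_{a_1}\otimes\cdots\otimes\sigma_{a_n}$, $a_i\in\mathbb{F}_2^2$, with $\sigma_{00}=\mathbb 1$; $|\mathrm{supp}(\sigma_a)|=|\{i:a_i\neq 0\}|$. Stabilizer norm $\lVert O\rVert_{\mathrm{st}}=d^{-1}\sum_a|(\sigma_a|O)|$; $\lVert\cdot\rVert_2$ Hilbert–Schmidt norm; $\lVert\cdot\rVert_\infty$ spectral norm. *)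

(* Defs.v *)
From HB Require Import structures.
From mathcomp Require Import all_boot all_order all_algebra.
From mathcomp Require Import complex mxtens.
From mathcomp Require Import classical_sets reals.

Set Implicit Arguments.
Unset Strict Implicit.
Unset Printing Implicit Defensive.

Import Order.TTheory GRing.Theory Num.Theory.
Local Open Scope ring_scope.

Section Generic.
Variable C : numClosedFieldType.

Definition adj {m p : nat} (A : 'M[C]_(m, p)) : 'M[C]_(p, m) :=
  map_mx Num.conj A^T.

Definition hs {m : nat} (A B : 'M[C]_m) : C := \tr (adj A *m B).

Definition is_hermitian {m : nat} (A : 'M[C]_m) : Prop := adj A = A.

Definition is_unitary {m : nat} (U : 'M[C]_m) : Prop := U *m adj U = 1%:M.

Definition psd {m : nat} (A : 'M[C]_m) : Prop :=
  forall v : 'cV[C]_m, 0 <= (adj v *m A *m v) 0 0.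

Definition density {m : nat} (rho : 'M[C]_m) : Prop :=
  psd rho /\ \tr rho = 1.

(* quantum channel (CPTP map), given in Kraus form *)
Definition is_channel {m : nat} (Phi : 'M[C]_m -> 'M[C]_m) : Prop :=
  exists Ks : seq 'M[C]_m,
    (forall X, Phi X = \sum_(K <- Ks) K *m X *m adj K) /\
    \sum_(K <- Ks) adj K *m K = 1%:M.

Definition omega {m : nat} (g X : 'M[C]_m) : 'M[C]_m := g *m X *m adj g.
Definition omegaA {m : nat} (g X : 'M[C]_m) : 'M[C]_m := adj g *m X *m g.

(* omega(g) = omega(h) as superoperators (checked on the matrix units) *)
Definition same_chan {m : nat} (g h : 'M[C]_m) : bool :=
  [forall i, forall j, omega g (delta_mx i j) == omega h (delta_mx i j)].

Definition Eb {m : nat} (x : 'I_m) : 'M[C]_m := delta_mx x x.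

Definition Mmeas {m : nat} (X : 'M[C]_m) : 'M[C]_m :=
  \sum_(x < m) hs (Eb x) X *: Eb x.

Definition frameS {m : nat} (G : seq 'M[C]_m) (X : 'M[C]_m) : 'M[C]_m :=
  (size G)%:R^-1 *: \sum_(g <- G) omegaA g (Mmeas (omega g X)).

Definition frameSinv {m : nat} (G : seq 'M[C]_m) (X : 'M[C]_m) : 'M[C]_m :=
  vec_mx (mxvec X *m invmx (lin_mx (frameS G))).

Definition ohat {m : nat} (G : seq 'M[C]_m) (O g : 'M[C]_m) (x : 'I_m) : C :=
  hs O (frameSinv G (omegaA g (Eb x))).

Definition prob {m : nat} (Lam : 'M[C]_m -> 'M[C]_m -> 'M[C]_m)
  (rho g : 'M[C]_m) (x : 'I_m) : C := (omega g (Lam g rho)) x x.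

Definition expect {m : nat} (G : seq 'M[C]_m) (Lam : 'M[C]_m -> 'M[C]_m -> 'M[C]_m)
  (rho : 'M[C]_m) (f : 'M[C]_m -> 'I_m -> C) : C :=
  (size G)%:R^-1 * \sum_(g <- G) \sum_(x < m) prob Lam rho g x * f g x.

Definition variance {m : nat} (G : seq 'M[C]_m) (Lam : 'M[C]_m -> 'M[C]_m -> 'M[C]_m)
  (rho O : 'M[C]_m) : C :=
  let mu := expect G Lam rho (ohat G O) in
  expect G Lam rho (fun g x => `|ohat G O g x - mu| ^+ 2).

Definition traceless {m : nat} (O : 'M[C]_m) : 'M[C]_m :=
  O - (\tr O / m%:R) *: 1%:M.

(* G lists g's whose superoperators omega(g) are uniformly distributed
   over {omega(U) | P U}: every element satisfies P, and every channel
   omega(U) with P U occurs the same (positive) number of times. *)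
Definition uniform_on {m : nat} (P : 'M[C]_m -> Prop) (G : seq 'M[C]_m) : Prop :=
  (forall g, g \in G -> P g) /\
  exists k : nat, (0 < k)%N /\ forall U, P U -> count (same_chan U) G = k.

End Generic.

Section Qubits.
Variable C : numClosedFieldType.

Fixpoint tensn (n : nat) (u : nat -> 'M[C]_2) : 'M[C]_(2 ^ n) :=
  match n return 'M[C]_(2 ^ n) with
  | 0 => 1%:M
  | n'.+1 => castmx (esym (expnS 2 n'), esym (expnS 2 n'))
                (u 0%N *t tensn n' (fun k => u k.+1))
  end.

(* single-qubit Paulis sigma_{(a1,a2)} labelled by F_2^2 = 'I_2 * 'I_2:
   (0,0) -> 1, (1,0) -> X, (1,1) -> Y, (0,1) -> Z *)
Definition pX : 'M[C]_2 := \matrix_(i, j) (i != j)%:R.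
Definition pY : 'M[C]_2 :=
  \matrix_(i, j) (if i == j then 0 else if i == 0 then - 'i else 'i).
Definition pZ : 'M[C]_2 :=
  \matrix_(i, j) (if i == j then (if i == 0 then 1 else -1) else 0).

Definition pauli1 (b : 'I_2 * 'I_2) : 'M[C]_2 :=
  match val b.1, val b.2 with
  | 0, 0 => 1%:M
  | _, 0 => pX
  | 0, _ => pZ
  | _, _ => pY
  end.

Definition pauli (n : nat) (a : {ffun 'I_n -> 'I_2 * 'I_2}) : 'M[C]_(2 ^ n) :=
  tensn n (fun k => if insub k is Some k' then pauli1 (a k') else 1%:M).

Definition psupp (n : nat) (a : {ffun 'I_n -> 'I_2 * 'I_2}) : nat :=
  #|[set i | a i != (0, 0)]|.

Definition stnorm (n : nat) (O : 'M[C]_(2 ^ n)) : C :=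
  (2 ^ n)%:R^-1 * \sum_(a : {ffun 'I_n -> 'I_2 * 'I_2}) `|hs (pauli a) O|.

Definition clifford (n : nat) (U : 'M[C]_(2 ^ n)) : Prop :=
  is_unitary U /\
  forall a, exists b, exists c : C,
    c ^+ 4 = 1 /\ U *m pauli a *m adj U = c *: pauli (n := n) b.

Definition local_clifford (n : nat) (U : 'M[C]_(2 ^ n)) : Prop :=
  exists u : nat -> 'M[C]_2,
    (forall k, (k < n)%N -> clifford (n := 1) (u k)) /\ U = tensn n u.

End Qubits.

Section Spectral.
Variable R : realType.

Definition vnorm {m : nat} (v : 'cV[R[i]]_m) : R :=
  Num.sqrt (complex.Re ((adj v *m v) 0 0)).

Definition specnorm {m : nat} (A : 'M[R[i]]_m) : R :=
  sup [set vnorm (A *m v) | v in [set v : 'cV[R[i]]_m | vnorm v <= 1]].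

End Spectral.

(* Main.v *)
(* Write [sigma_a] for the Paulis and [s_a] for the probability, over the
   sampling group, that [g sigma_a g^+] is diagonal.  The frame operator is
   diagonal in the Pauli basis with eigenvalues [s_a], and the diagonal entries
   of [g sigma_a g^+] have modulus 1 if it is diagonal and vanish otherwise.
   Hence, whatever the noise and the outcome [x], the estimator (up to its
   constant [a = 0] term, which does not affect the variance) satisfies
     [|o(g,x)| <= d^-1 \sum_a s_a^-1 * 1(g sigma_a g^+ diagonal) * |(sigma_a|O)|],
   and the variance is at most the average over [g] of the square of this bound.

   Global group: [s_a] and the joint probabilities for a commuting pair are
   invariant under the transvections implemented by [(1 + i sigma_c) / sqrt 2],
   hence constant; as exactly [d] Paulis become diagonal under each [g],
   counting gives [s_a = 1/(d+1)] and the joint probability [2/((d+1)(d+2))]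
   (it is 0 for anticommuting pairs).
   Local group: counting factorizes over the qubits and gives [s_a = 3^-|a|];
   for a k-local observable one applies the Cauchy-Schwarz inequality with
   weights [3^|a|], whose sum over the Paulis on the first [k] qubits that
   become diagonal under [g] is [4^k]. *)
Require Import Defs.
From HB Require Import structures.
From mathcomp Require Import all_boot all_order all_algebra.
From mathcomp Require Import complex mxtens.
From mathcomp Require Import classical_sets reals.
From mathcomp Require Import ring zify.
(* [is_unitary] would otherwise denote the predicate of [sesquilinear]. *)
Import Defs.

Set Implicit Arguments.
Unset Strict Implicit.
Unset Printing Implicit Defensive.

Import Order.TTheory GRing.Theory Num.Theory.
Local Open Scope ring_scope.

(** * Tensor products of 2x2 matrices *)

(* Binary digits, most significant first: [dig x k] indexes the [k]-th tensor
   factor of [tensn]. *)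
Fixpoint dig n : 'I_(2 ^ n) -> nat -> 'I_2 :=
  match n with
  | 0 => fun _ _ => ord0
  | n'.+1 => fun x k =>
    let p := mxtens_unindex (cast_ord (expnS 2 n') x) in
    if k is k'.+1 then dig p.2 k' else p.1
  end.

(** The binary digit of weight [2 ^ (n.-1 - k)]; comparing digits through this formula avoids
    reasoning about nested casts in [dig_split]. *)
Lemma val_dig n (x : 'I_(2 ^ n)) k : (k < n)%N ->
  val (dig x k) = ((x %/ 2 ^ (n.-1 - k)) %% 2)%N.
Proof.
elim: n x k => [|n IHn] x [|k] //= lt_kn.
  rewrite subn0 modn_small // ltn_divLR ?expn_gt0 // -expnS.
  exact: ltn_ord.
rewrite IHn //= subnS -subn1 subnAC subn1 !modn_divl modn_dvdm //.
by rewrite -expnS dvdn_exp2l //; lia.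
Qed.

Lemma dig_inj n (x y : 'I_(2 ^ n)) :
  (forall k : 'I_n, dig x k = dig y k) -> x = y.
Proof.
elim: n x y => [|n IHn] x y eq_xy; first by apply: val_inj;
  case: x y {eq_xy} => [[|x] ?] [[|y] ?].
apply: (@cast_ord_inj _ _ (expnS 2 n)).
apply: (can_inj (@mxtens_unindexK _ _)).
rewrite [LHS]surjective_pairing [RHS]surjective_pairing; congr (_, _).
  exact: eq_xy ord0.
by apply: IHn => k; exact: eq_xy (lift ord0 k).
Qed.

Lemma dig_split k m (x : 'I_(2 ^ (k + m))) :
  let p := mxtens_unindex (cast_ord (expnD 2 k m) x) in
  (forall j : 'I_k, dig x j = dig p.1 j) /\
  (forall j : 'I_m, dig x (k + j) = dig p.2 j).
Proof.
split=> j; have lt_j := ltn_ord j; apply: val_inj.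
  rewrite !val_dig ?ltn_addr //= -divnMA -expnD.
  by congr (_ %/ 2 ^ _ %% _)%N; lia.
rewrite !val_dig ?ltn_add2l //= !modn_divl modn_dvdm; last first.
  by rewrite -expnS dvdn_exp2l //; lia.
by congr (_ %% (_ * 2 ^ _) %/ 2 ^ _)%N; lia.
Qed.

Lemma ord2P (i : 'I_2) : i = 0 \/ i = 1.
Proof. by case: i => [[|[|//]] lt_i]; [left | right]; apply: val_inj. Qed.

Lemma mx2P (T : Type) (A B : 'M[T]_2) :
  A 0 0 = B 0 0 -> A 0 1 = B 0 1 -> A 1 0 = B 1 0 -> A 1 1 = B 1 1 -> A = B.
Proof.
move=> h00 h01 h10 h11; apply/matrixP => i j.
by case: (ord2P i) (ord2P j) => -> [] ->.
Qed.

Section Tensor.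
Variable C : numClosedFieldType.
Implicit Types (u v : nat -> 'M[C]_2).

(** Digit strings biject with indices, being an injection between sets of equal size, so the sum of
    products distributes qubit by qubit. *)
Lemma sum_dig n (F : nat -> 'I_2 -> C) :
  \sum_(x < 2 ^ n) \prod_(k < n) F k (dig x k) = \prod_(k < n) \sum_j F k j.
Proof.
pose digf (x : 'I_(2 ^ n)) := [ffun k : 'I_n => dig x k].
have digf_bij : bijective digf.
  apply: inj_card_bij; last by rewrite card_ffun !card_ord.
  by move=> x y /ffunP eq_xy; apply: dig_inj => k; have := eq_xy k; rewrite !ffunE.
rewrite bigA_distr_bigA (reindex digf); last exact: onW_bij.
by apply: eq_bigr => x _; apply: eq_bigr => k _; rewrite ffunE.
Qed.

Lemma tensnE n u x y :
  tensn n u x y = \prod_(k < n) u k (dig x k) (dig y k).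
Proof.
elim: n u x y => [|n IHn] u x y /=.
  by rewrite big_ord0 !ord1 mxE.
by rewrite castmxE mxE esymK IHn big_ord_recl.
Qed.

Lemma eq_tensn n u v : (forall k, (k < n)%N -> u k = v k) -> tensn n u = tensn n v.
Proof.
by move=> eq_uv; apply/matrixP => x y; rewrite !tensnE; apply: eq_bigr => k _;
  rewrite eq_uv.
Qed.

Lemma tensn_mul n u v : tensn n u *m tensn n v = tensn n (fun k => u k *m v k).
Proof.
apply/matrixP => x y; rewrite mxE tensnE.
under eq_bigr do rewrite !tensnE -big_split /=.
rewrite (sum_dig n (fun k j => u k (dig x k) j * v k j (dig y k))).
by apply: eq_bigr => k _; rewrite mxE.
Qed.

Lemma adj_tensn n u : adj (tensn n u) = tensn n (fun k => adj (u k)).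
Proof.
apply/matrixP => x y; rewrite !mxE !tensnE rmorph_prod.
by apply: eq_bigr => k _; rewrite !mxE.
Qed.

Lemma mxtrace_tensn n u : \tr (tensn n u) = \prod_(k < n) \tr (u k).
Proof.
rewrite /mxtrace -(sum_dig n (fun k j => u k j j)); apply: eq_bigr => x _;
  exact: tensnE.
Qed.

Lemma tensn1 n : tensn n (fun=> 1%:M) = 1%:M :> 'M[C]_(2 ^ n).
Proof.
apply/matrixP => x y; rewrite tensnE mxE; have [->|ne_xy] := eqVneq x y.
  by rewrite big1 // => k _; rewrite mxE eqxx.
have [k ne_k] : exists k : 'I_n, dig x k != dig y k.
  apply/existsP; apply: contraNT ne_xy; rewrite negb_exists => /forallP eq_xy.
  by apply/eqP/dig_inj => k; have := eq_xy k; rewrite negbK => /eqP.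
by rewrite (bigD1 k) //= mxE (negPf ne_k) mul0r.
Qed.

Lemma tensnZ n (c : 'I_n -> C) u v :
  (forall k : 'I_n, u k = c k *: v k) ->
  tensn n u = (\prod_k c k) *: tensn n v.
Proof.
move=> eq_u; apply/matrixP => x y; rewrite mxE !tensnE -big_split /=.
by apply: eq_bigr => k _; rewrite eq_u mxE.
Qed.

Lemma tensn_split k m u :
  tensn (k + m) u = castmx (esym (expnD 2 k m), esym (expnD 2 k m))
    (tensn k u *t tensn m (fun j => u (k + j)%N)).
Proof.
apply/matrixP => x y; rewrite castmxE mxE /= esymK !tensnE big_split_ord /=.
have [x1 x2] := dig_split x; have [y1 y2] := dig_split y.
by congr (_ * _); apply: eq_bigr => j _ /=; rewrite ?x1 ?y1 ?x2 ?y2.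
Qed.

Lemma mxtrace_tens m n (A : 'M[C]_m) (B : 'M[C]_n) :
  \tr (A *t B) = \tr A * \tr B.
Proof.
rewrite /mxtrace mulr_sum; apply: eq_bigr => x _.
by rewrite mxE.
Qed.

Lemma adj_tens m n (A : 'M[C]_m) (B : 'M[C]_n) : adj (A *t B) = adj A *t adj B.
Proof. by rewrite /adj trmx_tens map_mxT. Qed.

End Tensor.

(** * Adjoints, the Hilbert-Schmidt product and conjugation by unitaries *)

Section Adjoint.
Variable C : numClosedFieldType.

Lemma adjM m n p (A : 'M[C]_(m, n)) (B : 'M[C]_(n, p)) :
  adj (A *m B) = adj B *m adj A.
Proof. by rewrite /adj trmx_mul map_mxM. Qed.

Lemma adjK m n (A : 'M[C]_(m, n)) : adj (adj A) = A.
Proof. by apply/matrixP => i j; rewrite !mxE conjCK. Qed.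

Lemma adjD m n (A B : 'M[C]_(m, n)) : adj (A + B) = adj A + adj B.
Proof. by apply/matrixP => i j; rewrite !mxE rmorphD. Qed.

Lemma adjZ m n (c : C) (A : 'M[C]_(m, n)) : adj (c *: A) = c^* *: adj A.
Proof. by apply/matrixP => i j; rewrite !mxE rmorphM. Qed.

Lemma adj_scalar1 m : adj (1%:M : 'M[C]_m) = 1%:M.
Proof. by rewrite /adj trmx1 map_mx1. Qed.

Lemma hsE m (A B : 'M[C]_m) : hs A B = \sum_i \sum_j (A i j)^* * B i j.
Proof.
rewrite /hs /mxtrace exchange_big; apply: eq_bigr => j _ /=.
by rewrite mxE; apply: eq_bigr => i _; rewrite !mxE.
Qed.

Lemma hsC m (A B : 'M[C]_m) : (hs A B)^* = hs B A.
Proof.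
rewrite !hsE rmorph_sum; apply: eq_bigr => i _; rewrite rmorph_sum.
by apply: eq_bigr => j _; rewrite rmorphM /= conjCK mulrC.
Qed.

Lemma hs_is_linear m (A : 'M[C]_m) : linear_for *%R (hs A).
Proof. by move=> c X Y; rewrite /hs mulmxDr -scalemxAr linearP. Qed.
HB.instance Definition _ m (A : 'M[C]_m) :=
  GRing.isLinear.Build C 'M[C]_m C *%R (hs A) (hs_is_linear A).

Lemma omega_is_linear m (g : 'M[C]_m) : linear (omega g).
Proof. by move=> c X Y; rewrite /omega mulmxDr mulmxDl -scalemxAr -scalemxAl. Qed.
HB.instance Definition _ m (g : 'M[C]_m) :=
  GRing.isLinear.Build C 'M[C]_m 'M[C]_m _ (omega g) (omega_is_linear g).

Lemma omegaAE m (g : 'M[C]_m) : omegaA g = omega (adj g).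
Proof. by rewrite /omega /omegaA adjK. Qed.

Lemma unitary_adj m (g : 'M[C]_m) : is_unitary g -> adj g *m g = 1%:M.
Proof. exact: mulmx1C. Qed.

Lemma omegaK m (g : 'M[C]_m) : is_unitary g -> cancel (omega g) (omegaA g).
Proof.
move=> /unitary_adj gg X.
by rewrite /omega /omegaA !mulmxA gg mul1mx -mulmxA gg mulmx1.
Qed.

Lemma omegaM m (g h X : 'M[C]_m) : omega (g *m h) X = omega g (omega h X).
Proof. by rewrite /omega adjM !mulmxA. Qed.

Lemma omega_mul m (g X Y : 'M[C]_m) : is_unitary g ->
  omega g (X *m Y) = omega g X *m omega g Y.
Proof.
move=> /unitary_adj gg; rewrite /omega !mulmxA; congr (_ *m _ *m _).
by rewrite -(mulmxA _ (adj g) g) gg mulmx1.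
Qed.

Lemma omega1 m (g : 'M[C]_m) : is_unitary g -> omega g 1%:M = 1%:M.
Proof. by move=> gu; rewrite /omega mulmx1. Qed.

Lemma adj_omega m (g X : 'M[C]_m) : adj (omega g X) = omega g (adj X).
Proof. by rewrite /omega !adjM adjK mulmxA. Qed.

Lemma hs_omega m (g A B : 'M[C]_m) : hs A (omegaA g B) = hs (omega g A) B.
Proof.
by rewrite /hs adj_omega /omega /omegaA mulmxA mxtrace_mulC !mulmxA.
Qed.

Lemma unitaryM m (g h : 'M[C]_m) :
  is_unitary g -> is_unitary h -> is_unitary (g *m h).
Proof.
rewrite /is_unitary adjM => gu hu.
by rewrite mulmxA -(mulmxA g) hu mulmx1.
Qed.

End Adjoint.

(** * Single-qubit Pauli matrices *)

Section Pauli1.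
Variable C : numClosedFieldType.

(** The symplectic form on $\mathbb{F}_2^2$, with arithmetic of ['I_2] modulo 2; its value is 1
    exactly when the two Paulis anticommute. *)
Definition symp1 (b c : 'I_2 * 'I_2) : 'I_2 := b.1 * c.2 + b.2 * c.1.

Lemma pauli_label_ind (Q : 'I_2 * 'I_2 -> Prop) :
  Q (0, 0) -> Q (0, 1) -> Q (1, 0) -> Q (1, 1) -> forall b, Q b.
Proof. by move=> ? ? ? ? [b c]; case: (ord2P b) (ord2P c) => -> [] ->. Qed.

Local Notation s1 := (@pauli1 C).

Lemma adj_pauli1 b : adj (s1 b) = s1 b.
Proof.
by elim/pauli_label_ind: b; apply: mx2P;
  rewrite !mxE /= ?rmorphN /= ?conjCi ?opprK ?rmorph1 ?rmorph0.
Qed.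

Lemma pauli1_mul b c :
  exists2 ph : C, ph ^+ 4 = 1 & s1 b *m s1 c = ph *: s1 (b + c).
Proof.
have i2 : 'i * 'i = -1 :> C by rewrite -expr2 sqrCi.
have i4 : 'i ^+ 4 = 1 :> C by rewrite (exprM _ 2 2) sqrCi sqrrN expr1n.
have mi4 : (- 'i) ^+ 4 = 1 :> C by rewrite exprNn i4 mulr1 -signr_odd expr0.
elim/pauli_label_ind: b; elim/pauli_label_ind: c;
  (exists 1; [exact: expr1n|by apply: mx2P;
    rewrite !mxE !big_ord_recl big_ord0 !mxE /=; ring: i2]) ||
  (exists 'i; [exact: i4|by apply: mx2P;
    rewrite !mxE !big_ord_recl big_ord0 !mxE /=; ring: i2]) ||
  (exists (- 'i); [exact: mi4|by apply: mx2P;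
    rewrite !mxE !big_ord_recl big_ord0 !mxE /=; ring: i2]).
Qed.

Lemma pauli1_comm b c : s1 b *m s1 c = (-1) ^+ symp1 b c *: (s1 c *m s1 b).
Proof.
elim/pauli_label_ind: b; elim/pauli_label_ind: c; rewrite /symp1;
apply: mx2P; rewrite !mxE !big_ord_recl !big_ord0 !mxE /=; ring.
Qed.

Lemma mxtrace_pauli1 b : \tr (s1 b) = 2 * (b == 0)%:R.
Proof.
elim/pauli_label_ind: b; rewrite /mxtrace !big_ord_recl big_ord0 !mxE /=; ring.
Qed.

(** The completeness relation of the Pauli basis, written entrywise so that it can be multiplied
    over the qubits in [pauli_complete]. *)
Lemma pauli1_complete p q p' q' :
  \sum_b (s1 b p q)^* * s1 b p' q' = 2 * ((p == p') && (q == q'))%:R.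
Proof.
have i2 : 'i * 'i = -1 :> C by rewrite -expr2 sqrCi.
rewrite (eq_bigr (fun b => (s1 (b.1, b.2) p q)^* * s1 (b.1, b.2) p' q')); last by case.
rewrite -(pair_bigA _ (fun b c => (s1 (b, c) p q)^* * s1 (b, c) p' q')) /=.
rewrite !big_ord_recl !big_ord0 /=.
case: (ord2P p) (ord2P q) (ord2P p') (ord2P q') => -> [] -> [] -> [] ->;
rewrite !mxE /= ?rmorphN /= ?conjCi ?opprK ?rmorph1 ?rmorph0; ring: i2.
Qed.

Lemma norm_diag_pauli1 b p : `|s1 b p p| = (b.1 == 0)%:R.
Proof.
elim/pauli_label_ind: b; case: (ord2P p) => ->;
by rewrite !mxE /= ?normrN ?normr1 ?normr0.
Qed.

Lemma diag_pauli1 b p q : b.1 == 0 -> p != q -> s1 b p q = 0.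
Proof.
by elim/pauli_label_ind: b; case: (ord2P p) (ord2P q) => -> [] ->; rewrite !mxE.
Qed.

End Pauli1.

(** * Pauli operators and transvections *)

Section Symplectic.
Variable n : nat.
Local Notation P := {ffun 'I_n -> 'I_2 * 'I_2}.
Implicit Types a b c : P.

Definition symp a b : 'I_2 := \sum_k symp1 (a k) (b k).

Lemma ord2_addrr (i : 'I_2) : i + i = 0.
Proof. by case: (ord2P i) => ->; apply: val_inj. Qed.

Lemma pauli_addaa a : a + a = 0.
Proof.
apply/ffunP => k; rewrite !ffunE; case: (a k) => i j.
by congr (_, _); rewrite /= ord2_addrr.
Qed.

Lemma pauli_addK a b : a + b + b = a.
Proof. by rewrite -addrA pauli_addaa addr0. Qed.

Lemma pauli_add_eq0 a b : (a + b == 0) = (a == b).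
Proof. by rewrite -(inj_eq (addIr b)) pauli_addK add0r. Qed.

Lemma sympDr a b c : symp a (b + c) = symp a b + symp a c.
Proof.
rewrite /symp -big_split; apply: eq_bigr => k _.
by rewrite /symp1 !ffunE /= !mulrDr addrACA.
Qed.

Lemma sympC a b : symp a b = symp b a.
Proof.
by apply: eq_bigr => k _; rewrite /symp1 addrC mulrC (mulrC (a k).1).
Qed.

Lemma sympDl a b c : symp (a + b) c = symp a c + symp b c.
Proof. by rewrite !(sympC _ c) sympDr. Qed.

Lemma sympaa a : symp a a = 0.
Proof. by rewrite /symp big1 // => k _; rewrite /symp1 mulrC ord2_addrr. Qed.

Lemma symp_nondeg a : a != 0 -> exists c, symp a c = 1.
Proof.
move=> a_neq0; have [k ak] : exists k, a k != 0.
  apply/existsP; apply: contraNT a_neq0; rewrite negb_exists => /forallP a0.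
  by apply/eqP/ffunP => k; rewrite ffunE; have := a0 k; rewrite negbK => /eqP.
have [p sp] : exists p, symp1 (a k) p = 1.
  elim/pauli_label_ind: (a k) ak => // _;
    by [exists (1, 0); apply: val_inj | exists (0, 1); apply: val_inj].
exists [ffun j => if j == k then p else 0].
rewrite /symp (bigD1 k) //= ffunE eqxx sp big1 ?addr0 // => j /negPf ne_jk.
by rewrite ffunE ne_jk /symp1 !mulr0 addr0.
Qed.

Lemma symp_separate a b : a != 0 -> a != b ->
  exists2 c, symp a c = 1 & symp b c = 0.
Proof.
move=> a0; rewrite -pauli_add_eq0 => /symp_nondeg[c].
(* This [c] pairs differently with [a] and [b]. If it pairs with them the wrong way round, it is
   corrected by a [c'] that pairs to 1 with [a]. *)
rewrite sympDl; case: (ord2P (symp a c)) (ord2P (symp b c)) => ac [] bc;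
  rewrite ac bc => // _; last by exists c.
have [c' ac'] := symp_nondeg a0.
case: (ord2P (symp b c')) => bc'; first by exists c'.
by exists (c + c'); rewrite sympDr ?ac ?ac' ?bc ?bc' ?add0r //; apply: val_inj.
Qed.

Lemma symp_common a b : a != 0 -> b != 0 ->
  exists2 c, symp a c = 1 & symp b c = 1.
Proof.
move=> /symp_nondeg[c ac] /symp_nondeg[c' bc'].
case: (ord2P (symp b c)) => bc; last by exists c.
case: (ord2P (symp a c')) => ac'; last by exists c'.
by exists (c + c'); rewrite sympDr ?ac ?ac' ?bc ?bc' ?add0r ?addr0.
Qed.

(** The relative form of [symp_common], carried out inside the labels orthogonal to [a]:
    [symp_separate] supplies the two candidates, and their sum covers the remaining case. *)
Lemma symp_common_perp a b b' : b != 0 -> b != a -> b' != 0 -> b' != a ->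
  exists c, [/\ symp a c = 0, symp b c = 1 & symp b' c = 1].
Proof.
move=> b0 ba b'0 b'a.
have [c bc ac] := symp_separate b0 ba; have [c' b'c' ac'] := symp_separate b'0 b'a.
case: (ord2P (symp b' c)) => b'c; last by exists c.
case: (ord2P (symp b c')) => bc'; last by exists c'.
by exists (c + c'); rewrite !sympDr ac ac' bc b'c b'c' bc' !(add0r, addr0).
Qed.

(** The symplectic transvection $a \mapsto a + [a,c]\,c$; by [omega_tv] it is the action on labels
    of conjugation by [tv c]. *)
Definition transv c a : P := if symp a c == 0 then a else a + c.

Lemma transv_fix a c : symp a c = 0 -> transv c a = a.
Proof. by rewrite /transv => ->; rewrite eqxx. Qed.

Lemma transv_move a b : symp a b = 1 -> transv (a + b) a = b.
Proof.
move=> ab; rewrite /transv sympDr sympaa add0r ab /=.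
by rewrite addrA pauli_addaa add0r.
Qed.

(** Transvections act transitively on nonzero labels: a common [c] pairing to 1 with both [a] and
    [b] is reached from each of them by one transvection. *)
Lemma transv_invariant (T : Type) (f : P -> T) :
    (forall a c, f (transv c a) = f a) ->
  forall a b, a != 0 -> b != 0 -> f a = f b.
Proof.
move=> f_inv a b a0 b0; have [c ac bc] := symp_common a0 b0.
by rewrite -(f_inv a (a + c)) transv_move // -(f_inv b (b + c)) transv_move.
Qed.

(** Again both labels are moved to a common [c], now chosen orthogonal to [a], so that the two
    transvections used fix [a]. *)
Lemma transv_invariant2 (T : Type) (f : P -> P -> T) :
    (forall a b c, f (transv c a) (transv c b) = f a b) ->
  forall a b b', b != 0 -> b != a -> b' != 0 -> b' != a ->
    symp a b = 0 -> symp a b' = 0 -> f a b = f a b'.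
Proof.
move=> f_inv a b b' b0 ba b'0 b'a ab ab'.
have [c [ac bc b'c]] := symp_common_perp b0 ba b'0 b'a.
rewrite -(f_inv a b (b + c)) transv_move // transv_fix ?sympDr ?ab ?ac ?addr0 //.
by rewrite -(f_inv a b' (b' + c)) transv_move // transv_fix ?sympDr ?ab' ?ac ?addr0.
Qed.

Lemma card_pauli : #|P| = (2 ^ n * 2 ^ n)%N.
Proof. by rewrite card_ffun card_prod !card_ord -expnMn. Qed.

(** Translation by a label that pairs to 1 with [a] exchanges the orthogonal of [a] with its
    complement, so each is half of the labels. *)
Lemma card_symp_perp a : a != 0 ->
  (2 * #|[set b | symp a b == 0%R]|)%N = (2 ^ n * 2 ^ n)%N.
Proof.
move=> /symp_nondeg[c ac]; rewrite -card_pauli -(cardsC [set b | symp a b == 0%R]).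
rewrite mul2n -addnn; congr (_ + _)%N.
rewrite -(card_imset _ (addIr c)); apply: eq_card => b; rewrite !inE.
apply/imsetP/idP => [[b' + ->]|]; first by rewrite inE sympDr ac => /eqP->.
move=> ab; exists (b + c); last by rewrite pauli_addK.
by case: (ord2P (symp a b)) ab; rewrite inE sympDr ac => ->.
Qed.

End Symplectic.

(** * The n-qubit Paulis as an orthogonal basis, and the unitaries realising transvections *)

Section Pauli.
Variables (C : numClosedFieldType) (n : nat).
Local Notation P := {ffun 'I_n -> 'I_2 * 'I_2}.
Local Notation d := (2 ^ n)%N.
Local Notation s := (@pauli C n).
Implicit Types a b c : P.

Definition pauli_seq a (k : nat) : 'M[C]_2 :=
  if insub k is Some k' then pauli1 C (a k') else 1%:M.

Lemma pauli_seqE a (k : 'I_n) : pauli_seq a k = pauli1 C (a k).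
Proof. by rewrite /pauli_seq valK. Qed.

Lemma pauliE a x y : s a x y = \prod_(k < n) pauli1 C (a k) (dig x k) (dig y k).
Proof. by rewrite [LHS]tensnE; apply: eq_bigr => k _; rewrite -pauli_seqE. Qed.

Lemma pauli_mul a b : exists2 ph : C, ph ^+ 4 = 1 & s a *m s b = ph *: s (a + b).
Proof.
have /fin_all_exists2[ph ph4 abE] (k : 'I_n) : exists2 c : C, c ^+ 4 = 1 &
    pauli1 C (a k) *m pauli1 C (b k) = c *: pauli1 C (a k + b k).
  exact: pauli1_mul.
exists (\prod_k ph k); first by rewrite -prodrXl big1.
rewrite tensn_mul; apply: tensnZ => k; rewrite -!/(pauli_seq _ _) !pauli_seqE.
by rewrite abE ffunE.
Qed.

Lemma pauli0 : s 0 = 1%:M.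
Proof. by rewrite -(tensn1 C n); apply: eq_tensn => k _; case: insub => // k';
  rewrite ffunE. Qed.

Lemma pauli_sqr a : s a *m s a = 1%:M.
Proof.
rewrite tensn_mul -(tensn1 C n); apply: eq_tensn => k _; case: insub => [k'|];
  last by rewrite mulmx1.
have i2 : 'i * 'i = -1 :> C by rewrite -expr2 sqrCi.
elim/pauli_label_ind: (a k'); apply: mx2P;
  rewrite !mxE !big_ord_recl big_ord0 !mxE /=; ring: i2.
Qed.

Lemma adj_pauli a : adj (s a) = s a.
Proof.
by rewrite adj_tensn; apply: eq_tensn => k _; case: insub => [k'|];
  rewrite ?adj_pauli1 ?adj_scalar1.
Qed.

Lemma sign_ord2D (i j : 'I_2) : (-1) ^+ (i + j)%R = (-1) ^+ i * (-1) ^+ j :> C.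
Proof.
by case: (ord2P i) (ord2P j) => -> [] ->; rewrite -exprD -signr_odd -[RHS]signr_odd.
Qed.

Lemma pauli_comm a b : s a *m s b = (-1) ^+ symp a b *: (s b *m s a).
Proof.
rewrite (big_morph (fun i : 'I_2 => (-1) ^+ i : C) sign_ord2D (erefl _)) !tensn_mul.
apply: tensnZ => k; rewrite -!/(pauli_seq _ _) !pauli_seqE.
exact: pauli1_comm.
Qed.

Lemma ffun_forall_eq0 a : (a == 0) = [forall k, a k == 0].
Proof.
apply/eqP/forallP => [-> k|a0]; first by rewrite ffunE.
by apply/ffunP => k; rewrite ffunE; apply/eqP.
Qed.

Lemma prodr_bool (b : 'I_n -> bool) : \prod_k (b k)%:R = [forall k, b k]%:R :> C.
Proof.
case: forallP => [bT|/forallP]; first by rewrite big1 // => k _; rewrite bT.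
by rewrite negb_forall => /existsP[k /negPf bF]; rewrite (bigD1 k) //= bF mul0r.
Qed.

Lemma mxtrace_pauli a : \tr (s a) = d%:R * (a == 0)%:R.
Proof.
rewrite mxtrace_tensn ffun_forall_eq0 -prodr_bool natrX -[X in _ ^+ X]card_ord
  -prodr_const.
rewrite -big_split; apply: eq_bigr => k _.
by rewrite -/(pauli_seq _ _) pauli_seqE mxtrace_pauli1.
Qed.

Lemma hs_pauli a b : hs (s a) (s b) = d%:R * (a == b)%:R.
Proof.
rewrite /hs adj_pauli; have [->|ne_ab] := eqVneq a b.
  by rewrite pauli_sqr mxtrace1 mulr1.
have [ph _ ->] := pauli_mul a b.
by rewrite mxtraceZ mxtrace_pauli pauli_add_eq0 (negPf ne_ab) !mulr0.
Qed.

Lemma pauli_complete x y x' y' :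
  \sum_a (s a x y)^* * s a x' y' = d%:R * ((x == x') && (y == y'))%:R.
Proof.
under eq_bigr do rewrite !pauliE rmorph_prod -big_split /=.
rewrite -(bigA_distr_bigA (fun (k : 'I_n) (b : 'I_2 * 'I_2) =>
  (pauli1 C b (dig x k) (dig y k))^* * pauli1 C b (dig x' k) (dig y' k))).
under eq_bigr do rewrite pauli1_complete.
rewrite big_split prodr_const card_ord -natrX prodr_bool;
  congr (_ * (nat_of_bool _)%:R).
apply/forallP/andP => [eq_d|[/eqP-> /eqP-> k]]; last by rewrite !eqxx.
by split; apply/eqP/dig_inj => k; have /andP[/eqP ? /eqP ?] := eq_d k.
Qed.

Lemma dim_neq0 : d%:R != 0 :> C.
Proof. by rewrite pnatr_eq0 -lt0n expn_gt0. Qed.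

Lemma pauli_expand X : X = d%:R^-1 *: \sum_a hs (s a) X *: s a.
Proof.
apply/matrixP => x' y'; rewrite mxE summxE.
have -> : \sum_a (hs (s a) X *: s a) x' y' =
    \sum_x \sum_y X x y * \sum_a (s a x y)^* * s a x' y'.
  under eq_bigr do rewrite mxE hsE mulr_suml.
  rewrite exchange_big; apply: eq_bigr => x _ /=.
  under eq_bigr do rewrite mulr_suml.
  rewrite exchange_big; apply: eq_bigr => y _ /=.
  by rewrite mulr_sumr; apply: eq_bigr => a _; rewrite mulrAC mulrC.
rewrite (bigD1 x') //= (bigD1 y') //= pauli_complete !eqxx.
rewrite !big1 ?addr0 => [|x /negPf ne_x|y /negPf ne_y].
- by rewrite mulr1 mulrC mulfK ?dim_neq0.
- by rewrite big1 // => y _; rewrite pauli_complete ne_x !mulr0.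
- by rewrite pauli_complete ne_y andbF !mulr0.
Qed.

Lemma pauli_parseval X : \sum_a `|hs (s a) X| ^+ 2 = d%:R * hs X X.
Proof.
rewrite [in RHS](pauli_expand X) -[X in hs X]pauli_expand linearZ linear_sum /=.
rewrite mulVKf ?dim_neq0 //; apply: eq_bigr => a _.
by rewrite linearZ /= normCK hsC.
Qed.

(** Labels without X component: tensor products of the identity and Z, which are exactly the
    diagonal Paulis. *)
Definition ztype a := [forall k, (a k).1 == 0].

Lemma norm_diag_pauli a x : `|s a x x| = (ztype a)%:R.
Proof.
rewrite pauliE normr_prod -prodr_bool.
by apply: eq_bigr => k _; rewrite norm_diag_pauli1.
Qed.

Lemma ztype_diag a x y : ztype a -> x != y -> s a x y = 0.
Proof.
move=> /forallP za; apply: contraNeq; rewrite pauliE => /prodf_neq0 nz.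
apply/eqP/dig_inj => k; apply/eqP; have := nz k isT; apply: contraNT => ne_k.
by rewrite diag_pauli1.
Qed.

Lemma ztype_symp a b : ztype a -> ztype b -> symp a b = 0.
Proof.
move=> /forallP za /forallP zb; rewrite /symp big1 // => k _.
by rewrite /symp1 (eqP (za k)) (eqP (zb k)) mul0r mulr0 addr0.
Qed.

(** This is $\exp(i\pi\sigma_c/4)$. *)
Definition tv c : 'M[C]_d := (sqrtC 2)^-1 *: (1%:M + 'i *: s c).

Lemma sqrtC2V : (sqrtC 2)^-1 * (sqrtC 2)^-1 = 2^-1 :> C.
Proof. by rewrite -invfM -expr2 sqrtCK. Qed.

Lemma adj_tv c : adj (tv c) = (sqrtC 2)^-1 *: (1%:M - 'i *: s c).
Proof.
have rconj : ((sqrtC 2)^-1)^* = (sqrtC 2)^-1 :> C.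
  by apply/CrealP; rewrite rpredV ger0_real // sqrtC_ge0 ler0n.
by rewrite /tv adjZ adjD adj_scalar1 adjZ adj_pauli conjCi rconj scaleNr.
Qed.

(** If the two Paulis commute, conjugation fixes $\sigma_a$; if they anticommute, it gives
    $\frac12(1+i\sigma_c)^2\sigma_a = i\sigma_c\sigma_a$. *)
Lemma omega_tv a c : exists2 ph : C, ph ^+ 4 = 1 &
  omega (tv c) (s a) = ph *: s (transv c a).
Proof.
have i2 : 'i * 'i = -1 :> C by rewrite -expr2 sqrCi.
rewrite /omega adj_tv /tv.
rewrite -!scalemxAl -scalemxAr scalerA sqrtC2V.
rewrite mulmxBr mulmx1 -scalemxAr mulmxDl mul1mx -scalemxAl mulmxDl -scalemxAl.
have e : s c *m s a *m s c = (-1) ^+ symp a c *: s a.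
  by rewrite -mulmxA (pauli_comm a c) -scalemxAr mulmxA pauli_sqr mul1mx.
rewrite e (pauli_comm a c).
rewrite /transv; case: (ord2P (symp a c)) => ->.
  rewrite eqxx (_ : (-1) ^+ (0%R : 'I_2) = 1 :> C) //; exists 1; first exact: expr1n.
  apply/matrixP => x y; rewrite !mxE /=.
  apply: (mulfI (_ : 2 != 0)); rewrite ?pnatr_eq0 // mulVKf ?pnatr_eq0 // !mul1r.
  by rewrite mulrDr mulrA i2; ring.
rewrite (_ : (-1) ^+ (1%R : 'I_2) = -1 :> C) ?expr1 //=.
have [ph ph4 ca] := pauli_mul c a.
exists ('i * ph); first by rewrite exprMn ph4 (exprM _ 2 2) sqrCi sqrrN !expr1n mulr1.
rewrite ca -scalerA; apply: (scalerI (_ : 2 != 0)); rewrite ?pnatr_eq0 //.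
rewrite [LHS]scalerA mulfV ?pnatr_eq0 // !scale1r !scaleN1r scalerDr (scalerA 'i
  'i) i2 (addrC c a).
apply/matrixP => x y; rewrite !mxE /=; ring.
Qed.

Lemma tv_unitary c : is_unitary (tv c).
Proof.
have i2 : 'i * 'i = -1 :> C by rewrite -expr2 sqrCi.
rewrite /is_unitary adj_tv /tv -scalemxAl -scalemxAr scalerA sqrtC2V.
rewrite mulmxDl mul1mx mulmxBr mulmx1 -scalemxAl -scalemxAr pauli_sqr (scalerA 'i
  'i) i2.
apply/matrixP => x y; rewrite !mxE.
apply: (mulfI (_ : 2 != 0)); rewrite ?pnatr_eq0 // mulVKf ?pnatr_eq0 //; ring.
Qed.

Lemma tv_clifford c : clifford (tv c).
Proof.
split=> [|a]; first exact: tv_unitary.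
by have [ph ph4 e] := omega_tv a c; exists (transv c a), ph.
Qed.

End Pauli.

(** * Averages, the frame operator and the variance *)

Section Shadow.
Variables (C : numClosedFieldType) (m : nat).
Implicit Types (g h X : 'M[C]_m) (G : seq 'M[C]_m) (f : 'M[C]_m -> C).

Lemma same_chanP g h : reflect (omega g =1 omega h) (same_chan g h).
Proof.
apply: (iffP forallP) => [eq_gh X|eq_gh i]; last by apply/forallP => j; rewrite eq_gh.
rewrite (matrix_sum_delta X) !linear_sum; apply: eq_bigr => i _.
rewrite !linear_sum; apply: eq_bigr => j _; rewrite !linearZ /=.
by have /forallP/(_ j)/eqP-> := eq_gh i.
Qed.

Lemma same_chanM g h V : is_unitary V ->
  same_chan (g *m V) h = same_chan g (h *m adj V).
Proof.
move=> Vu; apply/same_chanP/same_chanP => eq_gh X.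
  rewrite omegaM -eq_gh omegaM; congr omega.
  by rewrite -{1}(adjK V) -omegaAE omegaK // /is_unitary adjK unitary_adj.
by rewrite omegaM eq_gh omegaM -omegaAE omegaK.
Qed.

Definition avg G f : C := (size G)%:R^-1 * \sum_(g <- G) f g.

(* Replacing [g] by [g V] permutes the channels, each of which occurs equally
   often in [G]. *)
Lemma avg_translate (Q : 'M[C]_m -> Prop) G f V :
    uniform_on Q G -> is_unitary V ->
    (forall U, Q U -> Q (U *m V)) -> (forall U, Q U -> Q (U *m adj V)) ->
    (forall g h, same_chan g h -> f g = f h) ->
  avg G (fun g => f (g *m V)) = avg G f.
Proof.
move=> [GQ [k [k_gt0 Gk]]] Vu QV QVa f_chan; congr (_ * _).
have k_neq0 : k%:R != 0 :> C by rewrite pnatr_eq0 -lt0n.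
have countE (T : 'M[C]_m) : Q T -> k%:R = \sum_(h <- G) (same_chan T h)%:R :> C.
  by move=> /Gk <-; rewrite -sum1_count natr_sum big_mkcond;
    apply: eq_bigr => h _; case: same_chan.
apply: (mulfI k_neq0); rewrite !mulr_sumr.
(* Double counting of the pairs [(g, h)] for which [g *m V] and [h] induce the same channel: each
   [g] has [k] partners, and so has each [h]. *)
transitivity (\sum_(g <- G) \sum_(h <- G) (same_chan (g *m V) h)%:R * f h).
  apply: eq_big_seq => g /GQ/QV/countE->; rewrite mulr_suml; apply: eq_bigr => h _.
  by case: (boolP (same_chan _ _)) => [/f_chan->|]; rewrite ?mul0r.
rewrite exchange_big; apply: eq_big_seq => h /GQ/QVa/countE->.
rewrite mulr_suml; apply: eq_bigr => g _; rewrite same_chanM //.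
congr ((nat_of_bool _)%:R * _).
by apply/same_chanP/same_chanP => eq_gh X; rewrite eq_gh.
Qed.

Lemma size_uniform (Q : 'M[C]_m -> Prop) G U : uniform_on Q G -> Q U -> (0 < size G)%N.
Proof. by move=> [_ [k [k_gt0 Gk]]] /Gk kE;
  rewrite (leq_trans k_gt0) // -kE count_size. Qed.

Lemma avg_sum (I : finType) G (F : I -> 'M[C]_m -> C) :
  avg G (fun g => \sum_i F i g) = \sum_i avg G (F i).
Proof. by rewrite /avg exchange_big -mulr_sumr. Qed.

Lemma avgZ G c f : avg G (fun g => c * f g) = c * avg G f.
Proof. by rewrite /avg -mulr_sumr mulrCA. Qed.

Lemma avg_const G c : (0 < size G)%N -> avg G (fun=> c) = c.
Proof.
move=> G0; rewrite /avg big_const_seq count_predT iter_addr addr0 -[c *+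
  _]mulr_natl mulKf //.
by rewrite pnatr_eq0 -lt0n.
Qed.

Lemma eq_avg G f f' : (forall g, g \in G -> f g = f' g) -> avg G f = avg G f'.
Proof. by move=> eq_f; congr (_ * _); apply: eq_big_seq. Qed.

Lemma ler_avg G f f' : (forall g, g \in G -> f g <= f' g) -> avg G f <= avg G f'.
Proof.
move=> le_f; rewrite ler_wpM2l ?invr_ge0 ?ler0n // big_seq [leRHS]big_seq.
exact: ler_sum.
Qed.

Lemma hs_Eb (x : 'I_m) X : hs (Eb C x) X = X x x.
Proof.
rewrite hsE (bigD1 x) //= (bigD1 x) //= !big1 => [|y /negPf ne|y /negPf ne].
- by rewrite mxE !eqxx rmorph1 mul1r !addr0.
- by rewrite big1 // => z _; rewrite mxE ne rmorph0 mul0r.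
- by rewrite mxE ne andbF rmorph0 mul0r.
Qed.

Lemma Mmeas_is_linear : linear (@Mmeas C m).
Proof.
move=> c X Y; rewrite /Mmeas scaler_sumr -big_split; apply: eq_bigr => x _.
by rewrite linearP scalerDl scalerA.
Qed.
HB.instance Definition _ := GRing.isLinear.Build C 'M[C]_m 'M[C]_m _ (@Mmeas C m)
  Mmeas_is_linear.

Lemma frameS_is_linear G : linear (frameS G).
Proof.
move=> c X Y; rewrite /frameS scalerA mulrC -scalerA -scalerDr; congr (_ *: _).
by rewrite scaler_sumr -big_split; apply: eq_bigr => g _; rewrite omegaAE !linearP.
Qed.
HB.instance Definition _ G := GRing.isLinear.Build C 'M[C]_m 'M[C]_m _ (frameS G)
  (frameS_is_linear G).

(** In finite dimension a right inverse already makes the matrix of the frame operator invertible,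
    so [invmx] is a true inverse here and not its default value. *)
Lemma frameSinvE G (T : 'M[C]_m -> 'M[C]_m) X :
  cancel T (frameS G) -> frameSinv G X = T X.
Proof.
move=> TK; have L_unit : lin_mx (frameS G) \in unitmx.
  rewrite -row_full_unit -sub1mx; apply/row_subP => i.
  apply/submxP; exists (mxvec (T (vec_mx (row i 1%:M)))).
  by rewrite mul_vec_lin /= TK vec_mxK.
by rewrite /frameSinv -{1}(TK X) -(mul_vec_lin (frameS G)) mulmxK // mxvecK.
Qed.

Section Variance.
Variables (G : seq 'M[C]_m) (Lam : 'M[C]_m -> 'M[C]_m -> 'M[C]_m) (rho : 'M[C]_m).
Hypothesis G0 : (0 < size G)%N.
Hypothesis Gu : forall g, g \in G -> is_unitary g.
Hypothesis Lam_channel : forall g, g \in G -> is_channel (Lam g).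
Hypothesis rho_density : density rho.

Lemma prob_ge0 g x : g \in G -> 0 <= prob Lam rho g x.
Proof.
move=> /Lam_channel[Ks [KsE _]]; rewrite /prob KsE linear_sum summxE.
apply: sumr_ge0 => K _; have [rho_psd _] := rho_density.
(* The diagonal entry contributed by one Kraus operator is $v^\dagger\rho v$ with $v =
   (gK)^\dagger|x\rangle$. *)
have := rho_psd (adj (g *m K) *m delta_mx x 0).
rewrite adjM adjK /omega adjM !mulmxA.
rewrite (_ : adj _ = delta_mx 0 x); last first.
  by apply/matrixP => i j; rewrite !mxE rmorph_nat andbC.
have -> : 'e_x *m g *m K *m rho *m adj K *m adj g *m delta_mx x 0 =
    row x (col x (omega g (K *m rho *m adj K))).
  by rewrite rowE colE /omega !mulmxA.
by rewrite !mxE.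
Qed.

Lemma prob_sum g : g \in G -> \sum_x prob Lam rho g x = 1.
Proof.
move=> gG; have [Ks [KsE Ks1]] := Lam_channel gG; have [_ rho1] := rho_density.
transitivity (\tr (omega g (Lam g rho))) => //.
rewrite /omega mxtrace_mulC mulmxA (unitary_adj (Gu gG)) mul1mx KsE.
rewrite linear_sum /= -rho1 -[in RHS](mul1mx rho) -Ks1 mulmx_suml linear_sum.
by apply: eq_bigr => K _; rewrite /= mxtrace_mulC mulmxA.
Qed.

(** The second moment about any [t] exceeds the variance by $|t-\mu|^2$. For fixed [g] the outcome
    probabilities are nonnegative and sum to 1, so a bound uniform in [x] passes to the average over
    [g], whatever the noise. *)
Lemma variance_le (O : 'M[C]_m) (t : C) (B : 'M[C]_m -> C) :
    (forall g x, g \in G -> `|ohat G O g x - t| ^+ 2 <= B g) ->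
  variance G Lam rho O <= avg G B.
Proof.
move=> le_B; rewrite /variance; set o := ohat G O; set mu := expect _ _ _ o.
pose E (f : 'M[C]_m -> 'I_m -> C) := expect G Lam rho f.
have ED (f f' : 'M[C]_m -> 'I_m -> C) : E (fun g x => f g x + f' g x) = E f + E f'.
  rewrite /E /expect -mulrDr -big_split; congr (_ * _); apply: eq_bigr => g _.
  by rewrite -big_split; apply: eq_bigr => x _; rewrite mulrDr.
have EZ c (f : 'M[C]_m -> 'I_m -> C) : E (fun g x => c * f g x) = c * E f.
  rewrite /E /expect [RHS]mulrCA; congr (_ * _); rewrite mulr_sumr;
    apply: eq_bigr => g _.
  by rewrite mulr_sumr; apply: eq_bigr => x _; rewrite mulrCA.
have E1 : E (fun _ _ => 1) = 1.
  rewrite /E /expect -[RHS](avg_const 1 G0) /avg; congr (_ * _).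
  by apply: eq_big_seq => g gG; under eq_bigr do rewrite mulr1; exact: prob_sum.
have Econj (f : 'M[C]_m -> 'I_m -> C) : E (fun g x => (f g x)^*) = (E f)^*.
  rewrite /E /expect rmorphM fmorphV rmorph_nat rmorph_sum; congr (_ * _).
  apply: eq_big_seq => g gG; rewrite rmorph_sum; apply: eq_bigr => x _.
  by rewrite rmorphM; congr (_ * _); apply/esym/CrealP/ger0_real/prob_ge0.
have dev c : E (fun g x => `|o g x - c| ^+ 2) =
    E (fun g x => `|o g x| ^+ 2) - c^* * mu - c * mu^* + `|c| ^+ 2.
  have -> : E (fun g x => `|o g x - c| ^+ 2) =
    E (fun g x => `|o g x| ^+ 2 + (- c^* * o g x + (- c * (o g x)^* + `|c| ^+ 2 * 1))).
    congr (_ * _); apply: eq_bigr => g _; apply: eq_bigr => x _; congr (_ * _).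
    by rewrite !normCK rmorphB /=; ring.
  rewrite !ED !EZ E1 Econj -[E o]/mu; ring.
apply: (@le_trans _ _ (E (fun g x => `|o g x - t| ^+ 2))).
  rewrite -subr_ge0 [X in X - _]dev -/(E _) dev.
  have -> : forall a, a - t^* * mu - t * mu^* + `|t| ^+ 2 -
      (a - mu^* * mu - mu * mu^* + `|mu| ^+ 2) = `|t - mu| ^+ 2.
    by move=> a; rewrite !normCK rmorphB /=; ring.
  by rewrite exprn_ge0.
rewrite /E /expect -/(avg _ _); apply: ler_avg => g gG.
rewrite -[B g]mul1r -(prob_sum gG) mulr_suml; apply: ler_sum => x _.
by rewrite ler_wpM2l ?prob_ge0 ?le_B.
Qed.

End Variance.
End Shadow.

(** * Clifford unitaries *)

Section Clifford.
Variables (C : numClosedFieldType) (n : nat).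
Local Notation P := {ffun 'I_n -> 'I_2 * 'I_2}.
Local Notation d := (2 ^ n)%N.
Local Notation s := (@pauli C n).
Implicit Types (g h U V : 'M[C]_d).

Lemma norm_phase (ph : C) : ph ^+ 4 = 1 -> `|ph| = 1.
Proof.
by move=> ph4; apply/eqP; rewrite -(pexpr_eq1 (n := 4)) // -normrX ph4 normr1.
Qed.

Lemma phase_neq0 (ph : C) : ph ^+ 4 = 1 -> ph != 0.
Proof. by move=> /norm_phase ph1; rewrite -normr_gt0 ph1. Qed.

Lemma cliffordP g a : clifford g ->
  exists b, exists2 ph : C, ph ^+ 4 = 1 & omega g (s a) = ph *: s b.
Proof. by move=> [_ /(_ a)[b [ph [ph4 e]]]]; exists b, ph. Qed.

Lemma clifford1 : clifford (1%:M : 'M[C]_d).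
Proof.
split=> [|a]; first by rewrite /is_unitary adj_scalar1 mulmx1.
by exists a, 1; rewrite expr1n adj_scalar1 mulmx1 mul1mx scale1r.
Qed.

Lemma cliffordM g h : clifford g -> clifford h -> clifford (g *m h).
Proof.
move=> gC hC; split; first by apply: unitaryM; [case: gC | case: hC].
move=> a; have [b [ph ph4 e]] := cliffordP a hC.
have [c [ph' ph'4 e']] := cliffordP b gC.
exists c, (ph * ph'); split; first by rewrite exprMn ph4 ph'4 mulr1.
by rewrite -/(omega _ _) omegaM e linearZ /= e' scalerA.
Qed.

Lemma omegaA_pauli g a b (ph : C) : is_unitary g -> ph ^+ 4 = 1 ->
  omega g (s a) = ph *: s b -> omegaA g (s b) = ph^-1 *: s a.
Proof.
move=> gu ph4 e; rewrite -(scalerK (phase_neq0 ph4) (s b)) -e omegaAE linearZ /=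
  -omegaAE.
by rewrite omegaK.
Qed.

(** Up to phases [g] acts on the labels by an injective map [F], since distinct Paulis are
    orthogonal. On a finite set [F] is a permutation, and its inverse describes the action of
    [adj g]. *)
Lemma clifford_adj g : clifford g -> clifford (adj g).
Proof.
move=> gC; have gu : is_unitary g by case: gC.
split; first by rewrite /is_unitary adjK unitary_adj.
have /fin_all_exists[F FE] a : exists b, exists2 ph : C, ph ^+ 4 = 1 & omega g (s
  a) = ph *: s b.
  exact: cliffordP.
have F_inj : injective F.
  move=> a b eqF; have [ph ph4 ea] := FE a; have [ph' ph'4 eb] := FE b.
  have := omegaA_pauli gu ph4 ea; rewrite eqF (omegaA_pauli gu ph'4 eb).
  move/(congr1 (hs (s a))); rewrite !linearZ /= !hs_pauli eqxx mulr1.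
  case: eqVneq => // _ /esym/eqP.
  by rewrite !mulr0 mulf_eq0 invr_eq0 (negPf (phase_neq0 ph4)) (negPf (dim_neq0 C n)).
move=> b; have [F' _ F'K] := injF_bij F_inj.
have [ph ph4 e] := FE (F' b); exists (F' b), ph^-1; split.
  by rewrite exprVn ph4 invr1.
by rewrite adjK -/(omegaA g _) -[b in LHS]F'K (omegaA_pauli gu ph4 e).
Qed.

Definition basis0 : 'I_d := Ordinal (expn_gt0 2 n : (0 < d)%N).

(* For Clifford [g] this says that [omega g (pauli a)] is diagonal. *)
Definition zimg g a := omega g (s a) basis0 basis0 != 0.

Lemma zimgE g a b (ph : C) : ph ^+ 4 = 1 -> omega g (s a) = ph *: s b ->
  zimg g a = ztype b.
Proof.
move=> ph4 e; rewrite /zimg e mxE mulf_eq0 (negPf (phase_neq0 ph4)) /=.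
by rewrite -normr_eq0 norm_diag_pauli pnatr_eq0 eqb0 negbK.
Qed.

(** The value does not depend on [x]: testing the single entry [basis0] in [zimg] loses nothing, and
    bounds on the estimator hold for every outcome. *)
Lemma norm_omega_pauli g a x : clifford g -> `|omega g (s a) x x| = (zimg g a)%:R.
Proof.
move=> /(cliffordP a)[b [ph ph4 e]].
by rewrite (zimgE ph4 e) e mxE normrM (norm_phase ph4) mul1r norm_diag_pauli.
Qed.

Lemma zimg_same g h a : same_chan g h -> zimg g a = zimg h a.
Proof. by move=> /same_chanP eq_gh; rewrite /zimg eq_gh. Qed.

Lemma zimgM g V a b (ph : C) : ph != 0 -> omega V (s a) = ph *: s b ->
  zimg (g *m V) a = zimg g b.
Proof.
by move=> ph0 e; rewrite /zimg omegaM e linearZ mxE mulf_eq0 (negPf ph0).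
Qed.

Lemma zimg0 g : clifford g -> zimg g 0.
Proof.
move=> [gu _]; rewrite /zimg pauli0 omega1 // mxE eqxx.
exact: oner_neq0.
Qed.

(* The sum is that of the squared Pauli coefficients of the pure state
   [g^+ |0><0| g]. *)
Lemma zimg_sum g : clifford g -> \sum_a (zimg g a)%:R = d%:R :> C.
Proof.
move=> gC; have gu : is_unitary g by case: gC.
transitivity (\sum_a `|hs (s a) (omegaA g (Eb C basis0))| ^+ 2).
  apply: eq_bigr => a _; rewrite hs_omega -hsC norm_conjC hs_Eb norm_omega_pauli //.
  by case: zimg; rewrite ?expr1n ?expr0n.
rewrite pauli_parseval hs_omega omegaAE -[X in omega X (omega _ _)]adjK -omegaAE.
rewrite omegaK ?hs_Eb ?mxE ?eqxx ?mulr1 //.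
by rewrite /is_unitary adjK unitary_adj.
Qed.

Lemma pauli_neq0 a : s a != 0.
Proof.
apply/eqP => s0; have := hs_pauli C a a; rewrite s0 linear0 eqxx mulr1 => /esym/eqP.
by rewrite (negPf (dim_neq0 C n)).
Qed.

(** Two diagonal images commute, hence so do the original Paulis, conjugation being injective;
    anticommutation would then make their product vanish. *)
Lemma zimg_symp g a b : clifford g -> zimg g a -> zimg g b -> symp a b = 0.
Proof.
move=> gC; have gu : is_unitary g by case: gC.
have [a' [ph ph4 ea]] := cliffordP a gC; have [b' [ph' ph'4 eb]] := cliffordP b gC.
rewrite (zimgE ph4 ea) (zimgE ph'4 eb) => za zb.
have : omega g (s a *m s b) = omega g (s b *m s a).
  rewrite !omega_mul // ea eb -!scalemxAl -!scalemxAr (pauli_comm _ a')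
    ztype_symp // expr0 scale1r.
  by rewrite !scalerA mulrC.
move=> /(can_inj (omegaK gu)); rewrite pauli_comm.
case: (ord2P (symp a b)) => // ->; rewrite scaleN1r.
have [ph'' ph''4 ->] := pauli_mul C b a => /esym/eqP.
rewrite -addr_eq0 -mulr2n -scaler_nat !scaler_eq0 (negPf (pauli_neq0 _)).
by rewrite (negPf (phase_neq0 ph''4)) pnatr_eq0.
Qed.

(** [Mmeas] keeps only the diagonal, and the image of a Pauli is either diagonal or has zero
    diagonal. *)
Lemma Mmeas_omega_pauli g a : clifford g ->
  Mmeas (omega g (s a)) = (zimg g a)%:R *: omega g (s a).
Proof.
move=> /(cliffordP a)[b [ph ph4 e]];
  rewrite (zimgE ph4 e) e linearZ /= [RHS]scalerA mulrC -scalerA.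
congr (_ *: _); apply/matrixP => x y;
  rewrite !mxE summxE (bigD1 x) //= hs_Eb !mxE eqxx /=.
rewrite big1 => [|z /negPf ne_zx]; last by rewrite !mxE eq_sym ne_zx mulr0.
rewrite addr0; have [->|ne_xy] := eqVneq y x.
  have := norm_diag_pauli C b x; case: (ztype b) => [_|/eqP];
    first by rewrite mulr1 mul1r.
  by rewrite normr_eq0 => /eqP->; rewrite mul0r mulr0.
by rewrite mulr0; case: (boolP (ztype b)) => [/ztype_diag->|];
  rewrite ?mulr0 ?mul0r // eq_sym.
Qed.

Section Frame.
Variable G : seq 'M[C]_d.
Hypothesis GC : forall g, g \in G -> clifford g.

(** The probability $s_a$, which [frameS_pauli] shows to be the eigenvalue of the frame operator at
    [s a]. *)
Definition zprob a : C := avg G (fun g => (zimg g a)%:R).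

Lemma frameS_pauli a : frameS G (s a) = zprob a *: s a.
Proof.
rewrite /frameS /zprob /avg -scalerA scaler_suml; congr (_ *: _).
apply: eq_big_seq => g /GC gC; rewrite Mmeas_omega_pauli // omegaAE linearZ /= -omegaAE.
by rewrite omegaK //; case: gC.
Qed.

Hypothesis zprob_neq0 : forall a, zprob a != 0.

Lemma frameSinv_pauli X :
  frameSinv G X = d%:R^-1 *: \sum_a ((zprob a)^-1 * hs (s a) X) *: s a.
Proof.
apply: (frameSinvE (T := fun X =>
  d%:R^-1 *: \sum_a ((zprob a)^-1 * hs (s a) X) *: s a)) => Y.
rewrite [RHS]pauli_expand linearZ linear_sum /=; congr (_ *: _).
apply: eq_bigr => a _; rewrite linearZ /= frameS_pauli scalerA mulrAC mulVf //.
by rewrite mul1r.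
Qed.

Lemma ohat_pauli O g x : ohat G O g x =
  d%:R^-1 * \sum_a (zprob a)^-1 * (omega g (s a) x x)^* * (hs (s a) O)^*.
Proof.
rewrite /ohat frameSinv_pauli linearZ linear_sum /=; congr (_ * _).
apply: eq_bigr => a _; rewrite linearZ /= hsC hs_omega; congr (_ * _ * _).
by rewrite -hsC hs_Eb.
Qed.

Lemma zprob_ge0 a : 0 <= zprob a.
Proof. by rewrite mulr_ge0 ?invr_ge0 ?ler0n // sumr_ge0 // => g _; rewrite ler0n. Qed.

(** The predicate [Q] allows the constant [a = 0] term to be left out in the global case. *)
Lemma norm_pauli_estimate (Q : pred P) (O : 'M[C]_d) g x : clifford g ->
  `|d%:R^-1 * \sum_(a | Q a) (zprob a)^-1 * (omega g (s a) x x)^* * (hs (s a) O)^*|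
  <= d%:R^-1 * \sum_(a | Q a) (zprob a)^-1 * (zimg g a)%:R * `|hs (s a) O|.
Proof.
move=> gC; rewrite normrM ger0_norm ?invr_ge0 ?ler0n // ler_wpM2l ?invr_ge0 ?ler0n //.
apply: (le_trans (ler_norm_sum _ _ _)); apply: ler_sum => a _.
by rewrite !normrM !norm_conjC norm_omega_pauli // normfV ger0_norm // zprob_ge0.
Qed.

End Frame.
End Clifford.

(** * Local Clifford unitaries and qubitwise counting *)

Section Local.
Variables (C : numClosedFieldType) (n : nat).
Local Notation P := {ffun 'I_n -> 'I_2 * 'I_2}.
Local Notation d := (2 ^ n)%N.
Local Notation s := (@pauli C n).
Implicit Types (g h U V : 'M[C]_d).

Lemma pauli_1qubit (b : 'I_2 * 'I_2) : pauli C [ffun _ : 'I_1 => b] = pauli1 C b.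
Proof.
have dig1 (x : 'I_(2 ^ 1)) : dig x 0 = x.
  by apply: val_inj; rewrite val_dig //= divn1 modn_small //; exact: ltn_ord.
by apply/matrixP => x y; rewrite pauliE big_ord1 ffunE !dig1.
Qed.

Lemma sum_1qubit (F : 'I_2 * 'I_2 -> C) :
  \sum_(a : {ffun 'I_1 -> 'I_2 * 'I_2}) F (a ord0) = \sum_b F b.
Proof.
rewrite (reindex (fun b : 'I_2 * 'I_2 => [ffun=> b])); last first.
  exists (fun a : {ffun 'I_1 -> 'I_2 * 'I_2} => a ord0) => [b _|a _];
    first by rewrite ffunE.
  by apply/ffunP => k; rewrite ffunE (ord1 k).
by apply: eq_bigr => b _; rewrite ffunE.
Qed.

(** Of the four single-qubit Paulis exactly two get a diagonal image: the identity, of weight [al],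
    and one other, of weight [be]. *)
Lemma sum_omega_pauli1 (u : 'M[C]_(2 ^ 1)) (al be : C) (i : 'I_(2 ^ 1)) : clifford u ->
  \sum_(b : 'I_2 * 'I_2) (if b == 0 then al else be) * `|omega u (pauli1 C b) i
    i| = al + be.
Proof.
move=> uC; have sumE (F : 'I_2 * 'I_2 -> C) :
    \sum_(b : 'I_2 * 'I_2) F b * `|omega u (pauli1 C b) i i| =
    \sum_(a : {ffun 'I_1 -> 'I_2 * 'I_2}) F (a ord0) * (zimg u a)%:R.
  rewrite -(sum_1qubit (fun b => F b * `|omega u (pauli1 C b) i i|)).
  apply: eq_bigr => a _; rewrite -(norm_omega_pauli a i uC) -pauli_1qubit.
  by congr (_ * `|omega u (pauli C _) i i|); apply/ffunP => k; rewrite ffunE (ord1 k).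
rewrite (sumE (fun b =>
  if b == 0 then al else be)) (bigD1 (0 : {ffun 'I_1 -> 'I_2 * 'I_2})) //= ffunE
    eqxx zimg0 // mulr1; congr (_ + _).
rewrite (eq_bigr (fun a => be * (zimg u a)%:R)) => [|a a0]; last first.
  case: eqP => // a00; case/eqP: a0; apply/ffunP => k; by rewrite ffunE (ord1 k).
rewrite -mulr_sumr -[RHS]mulr1; congr (_ * _).
have := zimg_sum uC;
  rewrite (bigD1 (0 : {ffun 'I_1 -> 'I_2 * 'I_2})) //= zimg0 // expn1 =>
    /(canRL (addKr _)) ->.
by rewrite /=; ring.
Qed.

Lemma local_cliffordC g : local_clifford g -> clifford g.
Proof.
move=> [u [uC ->]]; split.
  rewrite /is_unitary adj_tensn tensn_mul -tensn1; apply: eq_tensn => k /uC[uu _].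
  exact: uu.
move=> a; have /fin_all_exists[F FE] (k : 'I_n) : exists b, exists2 ph : C, ph ^+
  4 = 1 &
    omega (u k) (pauli1 C (a k)) = ph *: pauli1 C b.
  have [b [ph ph4 e]] := cliffordP [ffun=> a k] (uC k (ltn_ord k)).
  have bE : [ffun=> b ord0] = b by apply/ffunP => j; rewrite ffunE (ord1 j).
  by exists (b ord0), ph => //; move: e; rewrite -{1}bE !pauli_1qubit.
have [ph ph4 FE'] := fin_all_exists2 FE.
exists (finfun F), (\prod_k ph k); split; first by rewrite -prodrXl big1.
rewrite adj_tensn !tensn_mul; apply: tensnZ => k.
by rewrite -/(pauli_seq _ _ _) -/(pauli_seq _ _ _) !pauli_seqE ffunE -/(omega _ _) FE'.
Qed.

Lemma local_cliffordM g h : local_clifford g -> local_clifford h ->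
  local_clifford (g *m h).
Proof.
move=> [u [uC ->]] [v [vC ->]]; exists (fun k => u k *m v k); split;
  last exact: tensn_mul.
by move=> k lt_kn; apply: cliffordM; [exact: uC | exact: vC].
Qed.

Lemma local_clifford_adj g : local_clifford g -> local_clifford (adj g).
Proof.
move=> [u [uC ->]]; exists (fun k => adj (u k)); split; last exact: adj_tensn.
by move=> k lt_kn; apply: clifford_adj; exact: uC.
Qed.

Lemma local_clifford1 : local_clifford (1%:M : 'M[C]_d).
Proof.
exists (fun=> 1%:M); split=> [k _|]; last by rewrite tensn1.
exact: clifford1.
Qed.

(** A generating function for the Paulis that [g] makes diagonal. Free weights per qubit let it
    serve both to count Paulis of a given support and to evaluate the Cauchy-Schwarz factor. *)
Lemma local_zimg_sum g (al be : 'I_n -> C) : local_clifford g ->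
  \sum_(a : P) (\prod_k (if a k == 0 then al k else be k)) * (zimg g a)%:R =
  \prod_k (al k + be k).
Proof.
move=> gL; have gC := local_cliffordC gL; case: gL gC => u [uC ->] gC.
pose w (k : 'I_n) (b : 'I_2 * 'I_2) : C := (if b == 0 then al k else be k) *
  `|omega (u k) (pauli1 C b) (dig (basis0 n) k) (dig (basis0 n) k)|.
transitivity (\sum_(a : P) \prod_k w k (a k)).
  apply: eq_bigr => a _; rewrite -(norm_omega_pauli a (basis0 n) gC).
  rewrite /omega adj_tensn !tensn_mul tensnE normr_prod -big_split.
  by apply: eq_bigr => k _; rewrite /= -/(pauli_seq _ _ _) pauli_seqE.
rewrite -bigA_distr_bigA.
by apply: eq_bigr => k _; apply: (sum_omega_pauli1 (u := u k)); exact: uC.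
Qed.

End Local.

(** * Global Clifford group: single and joint probabilities of diagonal images *)

Section GlobalClifford.
Variables (C : numClosedFieldType) (n : nat) (G : seq 'M[C]_(2 ^ n)).
Local Notation P := {ffun 'I_n -> 'I_2 * 'I_2}.
Local Notation d := (2 ^ n)%N.
Local Notation s := (@pauli C n).
Hypothesis G_unif : uniform_on (@clifford C n) G.
Let GC g : g \in G -> clifford g. Proof. by case: G_unif => GC _ /GC. Qed.
Let G0 : (0 < size G)%N. Proof. exact: size_uniform G_unif (clifford1 C n). Qed.

Definition zpair (a b : P) : C := avg G (fun g => (zimg g a && zimg g b)%:R).

(** Right translation by [tv c] preserves averages and moves both labels at once, up to phases that
    [zimg] ignores. *)
Lemma zpair_transv a b c : zpair (transv c a) (transv c b) = zpair a b.
Proof.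
have tvP e := omega_tv C e c.
rewrite /zpair -[RHS](avg_translate (V := tv C c) G_unif).
- apply: eq_avg => g gG.
  have [ph ph4 ea] := tvP a; have [ph' ph'4 eb] := tvP b.
  by rewrite (zimgM _ (phase_neq0 ph4) ea) (zimgM _ (phase_neq0 ph'4) eb).
- exact: tv_unitary.
- by move=> U /cliffordM; apply; exact: tv_clifford.
- by move=> U /cliffordM; apply; apply: clifford_adj; exact: tv_clifford.
- by move=> g h gh; rewrite !(zimg_same _ gh).
Qed.

Lemma zprob_zpair a : zprob G a = zpair a a.
Proof. by apply: eq_avg => g _; rewrite andbb. Qed.

Lemma zprob0 : zprob G 0 = 1.
Proof. by rewrite -[RHS](avg_const 1 G0); apply: eq_avg => g /GC/zimg0->. Qed.

Lemma sum_zprob : \sum_(a : P) zprob G a = d%:R.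
Proof.
by rewrite -avg_sum -[RHS](avg_const _ G0); apply: eq_avg => g /GC/zimg_sum.
Qed.

Lemma dim_gt1 (a : P) : a != 0 -> (1 < d)%N.
Proof.
by move=> a0; rewrite ltnNge; apply: contra a0 => d1; apply/eqP/ffunP => -[k kn];
  move: d1;
   rewrite leqNgt (leq_trans _ (ltn_expl n _)) ?ltnS // (leq_ltn_trans _ kn).
Qed.

Lemma zprob_global a : a != 0 -> zprob G a = (d%:R + 1)^-1.
Proof.
move=> a0; have d1 := dim_gt1 a0.
have constP b : b != 0 -> zprob G b = zprob G a.
  move=> b0; apply: (@transv_invariant n C (zprob G)) => // e c.
  by rewrite !zprob_zpair zpair_transv.
(* With a common value $s$ at the nonzero labels, the sum reads $1 + (d^2-1)s = d$. *)
have := sum_zprob; rewrite (bigD1 (0 : P)) //= zprob0 (eq_bigr (fun=> zprob G a)) //.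
rewrite sumr_const cardC1 card_pauli => /(canRL (addKr _)).
have dd : (d * d).-1%:R = (d%:R - 1) * (d%:R + 1) :> C.
  by rewrite -subn1 natrB ?muln_gt0 ?expn_gt0 // natrM; ring.
rewrite -[zprob G a *+ _]mulr_natr dd => e.
have dm1 : d%:R - 1 != 0 :> C by rewrite subr_eq0 (eqr_nat _ _ 1) neq_ltn d1 orbT.
have dp1 : d%:R + 1 != 0 :> C by rewrite natr1 pnatr_eq0.
apply: (mulfI dp1); rewrite mulfV //; apply: (mulfI dm1).
rewrite mulr1 [RHS]addrC -e; ring.
Qed.

(** Anticommuting Paulis never become diagonal together. For commuting ones equality holds:
    [zpair a] is constant on the set [N] of the labels other than 0 and [a] that commute with [a],
    and the constant is found by counting. *)
Lemma zpair_le a b : a != 0 -> b != 0 -> b != a ->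
  zpair a b <= 2 / ((d%:R + 1) * (d%:R + 2)).
Proof.
move=> a0 b0 ba.
have [ab|ab] := eqVneq (symp a b) 0; last first.
  rewrite /zpair (@eq_avg _ _ _ _ (fun=> 0)); last first.
    move=> g /GC gC; case: andP => // -[za zb].
    by rewrite (zimg_symp gC za zb) eqxx in ab.
  by rewrite avg_const // divr_ge0 ?mulr_ge0 ?addr_ge0 ?ler0n ?ler01.
pose N := [set b' | (symp a b' == 0) && ((b' != 0) && (b' != a))].
(* The orthogonal of [a] has $d^2/2$ elements, two of which, 0 and [a], are removed. *)
have card_N : (#|N| * 2 + 4 = d * d)%N.
  rewrite -(card_symp_perp a0) [in RHS](cardsD1 (0%R : P)) [in RHS](cardsD1 a)
    !inE !sympaa.
  rewrite a0 eqxx (_ : symp a 0 = 0) ?eqxx;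
    last by rewrite sympC -(pauli_addaa a) sympDl ord2_addrr.
  rewrite (_ : _ :\ a = N); first by rewrite !mulnDr mulnC addnC !addnA.
  by apply/setP => b'; rewrite !inE andbC -!andbA andbCA; do !bool_congr.
(* Both sides average [1(a diagonal) * #{b' in N diagonal}], and there are
   [d - 2] such [b'] once [a] is diagonal. *)
have sumN : #|N|%:R * zpair a b = (d%:R - 2) * (d%:R + 1)^-1.
  transitivity (\sum_(b' in N) zpair a b').
    rewrite mulr_natl -sumr_const; apply: eq_bigr => b'.
    rewrite inE => /and3P[/eqP ab' b'0 b'a].
    apply: transv_invariant2 => //; exact: zpair_transv.
  rewrite -(zprob_global a0) -avgZ big_mkcond /= /zpair.
  rewrite (eq_bigr (fun b' => avg G (fun g =>
    (b' \in N)%:R * (zimg g a && zimg g b')%:R))).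
    rewrite -avg_sum; apply: eq_avg => g /GC gC.
    case za: (zimg g a); last by rewrite big1 ?mulr0 // => b' _; rewrite mulr0.
    have := zimg_sum gC; rewrite (bigD1 (0 : P)) //= (bigD1 a) //= zimg0 // za => <-.
    rewrite [RHS](_ : _ = \sum_(i : P | (i != 0) && (i != a)) (zimg g i)%:R);
      last first.
      by rewrite /=; ring.
    rewrite (bigID (mem N)) /= [X in _ + X]big1 ?addr0;
      last by move=> b' /negPf->; rewrite mul0r.
    rewrite [in RHS](bigID (mem N)) /= [X in _ = _ + X]big1 ?addr0.
      apply: eq_big => [b'|b' ->]; last by rewrite mul1r.
      by rewrite inE; case: (b' != 0); case: (b' != a); rewrite ?andbF ?andbT.
    move=> b' /andP[/andP[b'0 b'a]]; rewrite inE b'0 b'a !andbT => ab'.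
    by case zb: (zimg g b') => //; rewrite (zimg_symp gC za zb) eqxx in ab'.
  by move=> b' _; case: (b' \in N); rewrite -?avgZ //; [apply: eq_avg => g _;
    rewrite mul1r |
    rewrite avgZ mul0r].
have N_gt0 : (0 < #|N|)%N.
  by apply/card_gt0P; exists b; rewrite inE ab eqxx b0 ba.
(* For $d = 2$ the set [N] would be empty, but it contains [b]. *)
have d2 : d%:R - 2 != 0 :> C.
  rewrite subr_eq0 (eqr_nat _ _ 2); apply/negP => /eqP d2; move: card_N; rewrite d2.
  by move: (#|N|) N_gt0 => N0 N_gt0; lia.
have dN : #|N|%:R = (d%:R - 2) * (d%:R + 2) / 2 :> C.
  have : (#|N| * 2 + 4)%:R = (d * d)%:R :> C by rewrite card_N.
  rewrite natrD !natrM => /(canRL (addrK _)) e.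
  apply: (mulIf (_ : 2 != 0)); rewrite ?pnatr_eq0 // e divfK ?pnatr_eq0 //; ring.
have dp1 : d%:R + 1 != 0 :> C by rewrite natr1 pnatr_eq0.
have dp2 : d%:R + 2 != 0 :> C by rewrite -natrD pnatr_eq0 addn2.
rewrite le_eqVlt; apply/orP; left; apply/eqP.
apply: (mulfI (_ : #|N|%:R != 0)); first by rewrite pnatr_eq0 -lt0n.
rewrite sumN dN; field.
by rewrite dp1 dp2.
Qed.

End GlobalClifford.

(** * Variance bound for global Clifford sampling *)

Section GlobalVariance.
Variables (C : numClosedFieldType) (n : nat) (G : seq 'M[C]_(2 ^ n)).
Local Notation P := {ffun 'I_n -> 'I_2 * 'I_2}.
Local Notation d := (2 ^ n)%N.
Local Notation s := (@pauli C n).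
Hypothesis G_unif : uniform_on (@clifford C n) G.
Let GC g : g \in G -> clifford g. Proof. by case: G_unif => GC _ /GC. Qed.
Let G0 : (0 < size G)%N. Proof. exact: size_uniform G_unif (clifford1 C n). Qed.

Lemma hs_traceless (O : 'M[C]_d) a :
  hs (s a) (traceless O) = if a == 0 then 0 else hs (s a) O.
Proof.
rewrite /traceless linearB linearZ /= -(pauli0 C n) hs_pauli.
case: eqP => [->|_]; last by rewrite !mulr0 subr0.
by rewrite mulr1 divfK ?dim_neq0 // pauli0 /hs adj_scalar1 mul1mx subrr.
Qed.

Theorem global_variance Lam (rho O : 'M[C]_d) :
    (forall g, g \in G -> is_channel (Lam g)) -> density rho ->
  variance G Lam rho O <=
    (2 * (d + 1))%N%:R / (d + 2)%N%:R * stnorm (traceless O) ^+ 2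
    + (d + 1)%N%:R / d%:R * hs (traceless O) (traceless O).
Proof.
move=> Lam_channel rho_density; set O0 := traceless O.
pose c (a : P) : C := `|hs (s a) O0|.
have d1 : d%:R + 1 != 0 :> C by rewrite natr1 pnatr_eq0.
have d2 : d%:R + 2 != 0 :> C by rewrite -natrD pnatr_eq0 addn2.
have zprobE a : zprob G a = if a == 0 then 1 else (d%:R + 1)^-1.
  by case: eqP => [->|/eqP]; [exact: zprob0 | exact: zprob_global].
have zprob_neq0 a : zprob G a != 0.
  by rewrite zprobE; case: ifP => _; rewrite ?oner_neq0 ?invr_eq0.
pose q : C := 2 / ((d%:R + 1) * (d%:R + 2)).
(* The normalisation $d^{-1}$ times the inverse eigenvalue $s_a^{-1} = d+1$ at nonzero labels. *)
pose K : C := d%:R^-1 * (d%:R + 1).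
have K_ge0 : 0 <= K by rewrite mulr_ge0 ?invr_ge0 ?addr_ge0 ?ler0n ?ler01.
have c_ge0 a : 0 <= c a by rewrite /c normr_ge0.
pose B (g : 'M[C]_d) : C := (K * \sum_(a : P | a != 0) (zimg g a)%:R * c a) ^+ 2.
have le_B : variance G Lam rho O <= avg G B.
  (* The centre [t] is the constant [a = 0] term of the estimator; subtracting it leaves only the
     Pauli coefficients of [traceless O]. *)
  apply: (variance_le G0 _ Lam_channel rho_density (t := d%:R^-1 * (hs (s 0)
    O)^*)) => [g /GC[]//|g x gG].
  have gC := GC gG; have gu : is_unitary g by case: gC.
  rewrite ler_sqr ?nnegrE ?normr_ge0 //; last first.
    by rewrite mulr_ge0 // sumr_ge0 // => a _; rewrite mulr_ge0 ?ler0n.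
  rewrite ohat_pauli // (bigD1 (0 : P)) //= zprobE eqxx invr1 mul1r.
  rewrite {1}pauli0 omega1 // mxE eqxx rmorph1 mul1r mulrDr addrAC subrr add0r.
  apply: le_trans; first exact: norm_pauli_estimate.
  rewrite /K -mulrA ler_wpM2l ?invr_ge0 ?ler0n // mulr_sumr.
  rewrite le_eqVlt; apply/orP; left; apply/eqP; apply: eq_bigr => a /negPf a0.
  by rewrite zprobE a0 invrK mulrA /c hs_traceless a0.
have c0 : c 0 = 0 by rewrite /c hs_traceless eqxx normr0.
have sum_c : \sum_(a : P | a != 0) c a = d%:R * stnorm O0.
  rewrite /stnorm mulVKf ?dim_neq0 // [in RHS](bigD1 (0 : P)) //=.
  by rewrite -/(c 0) c0 add0r.
have sum_c2 : \sum_(a : P | a != 0) c a ^+ 2 = d%:R * hs O0 O0.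
  by rewrite -pauli_parseval [in RHS](bigD1 (0 : P)) //= -/(c 0) c0 expr0n add0r.
apply: (le_trans le_B).
have -> : avg G B = K ^+ 2 *
    \sum_(a : P | a != 0) \sum_(b : P | b != 0) zpair G a b * (c a * c b).
  pose F (a b : P) (g : 'M[C]_d) : C := (zimg g a && zimg g b)%:R * (c a * c b).
  have -> : avg G B = avg G (fun g =>
    K ^+ 2 * \sum_(a : P | a != 0) \sum_(b : P | b != 0) F a b g).
    apply: eq_avg => g _; rewrite /B exprMn; congr (_ * _).
    rewrite expr2 mulr_suml; apply: eq_bigr => a _; rewrite mulr_sumr.
    by apply: eq_bigr => b _; rewrite /F mulrACA -natrM mulnb.
  rewrite avgZ; congr (_ * _); rewrite /avg exchange_big mulr_sumr;
    apply: eq_bigr => a _ /=.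
  rewrite exchange_big mulr_sumr; apply: eq_bigr => b _ /=.
  by rewrite /zpair /avg /F -mulr_suml [LHS]mulrA.
(* Allowing the extra [q] on the diagonal too makes the [q] part of the double sum a perfect square,
   which yields the stabilizer norm; the diagonal part yields the Hilbert-Schmidt norm. *)
have zpair_bound a b : a != 0 -> b != 0 ->
    zpair G a b <= (d%:R + 1)^-1 * (b == a)%:R + q.
  move=> a0 b0; have [->|ba] := eqVneq b a.
    rewrite -zprob_zpair zprobE (negPf a0) mulr1 lerDl.
    by rewrite divr_ge0 ?mulr_ge0 ?addr_ge0 ?ler0n ?ler01.
  by rewrite mulr0 add0r; apply: zpair_le.
apply: (@le_trans _ _ (K ^+ 2 * \sum_(a : P | a != 0) \sum_(b : P | b != 0)
    ((d%:R + 1)^-1 * (b == a)%:R + q) * (c a * c b))).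
  rewrite ler_wpM2l ?exprn_ge0 //.
  apply: ler_sum => a a0; apply: ler_sum => b b0.
  by rewrite ler_wpM2r ?mulr_ge0 ?zpair_bound.
rewrite le_eqVlt; apply/orP; left; apply/eqP.
transitivity (K ^+ 2 * ((d%:R + 1)^-1 * (\sum_(a : P | a != 0) c a ^+ 2)
    + q * (\sum_(a : P | a != 0) c a) ^+ 2)).
  congr (_ * _); rewrite [in RHS]expr2 mulr_suml !mulr_sumr -big_split.
  apply: eq_bigr => a a0 /=; under eq_bigr do rewrite mulrDl.
  rewrite big_split /=; congr (_ + _); last by rewrite !mulr_sumr.
  rewrite (bigD1 a) //= eqxx mulr1 expr2 big1 ?addr0 // => b /andP[_ /negPf->].
  by rewrite mulr0 mul0r.
rewrite sum_c sum_c2 /K /q natrD !natrM !natrD; field.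
by rewrite d1 d2 dim_neq0.
Qed.

End GlobalVariance.

(** * Local Clifford group: eigenvalues of the frame operator and variance bounds *)

Section LocalVariance.
Variables (C : numClosedFieldType) (n : nat) (G : seq 'M[C]_(2 ^ n)).
Local Notation P := {ffun 'I_n -> 'I_2 * 'I_2}.
Local Notation d := (2 ^ n)%N.
Local Notation s := (@pauli C n).
Hypothesis G_unif : uniform_on (@local_clifford C n) G.
Let GL g : g \in G -> local_clifford g. Proof. by case: G_unif => GL _ /GL. Qed.
Let GC g : g \in G -> clifford g. Proof. by move=> /GL; exact: local_cliffordC. Qed.
Let G0 : (0 < size G)%N. Proof. exact: size_uniform G_unif (local_clifford1 C n). Qed.

(** Distinct nontrivial single-qubit Paulis anticommute, so the transvection by their sum takes one
    to the other. *)
Lemma pauli1_move (p q : 'I_2 * 'I_2) : (p == 0) = (q == 0) ->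
  exists2 u : 'M[C]_(2 ^ 1), clifford u &
    exists2 ph : C, ph ^+ 4 = 1 & omega u (pauli1 C p) = ph *: pauli1 C q.
Proof.
have [->|ne_pq] := eqVneq p q => [_|pq].
  exists 1%:M; first exact: clifford1.
  by exists 1; rewrite ?expr1n // /omega adj_scalar1 mulmx1 mul1mx scale1r.
pose a : {ffun 'I_1 -> 'I_2 * 'I_2} := [ffun=> p].
pose b : {ffun 'I_1 -> 'I_2 * 'I_2} := [ffun=> q].
have ab : symp a b = 1.
  rewrite /symp big_ord1 !ffunE; move: p q ne_pq pq {a b}.
  by elim/pauli_label_ind; elim/pauli_label_ind => // _ _; apply: val_inj.
exists (tv C (a + b)); first exact: tv_clifford.
have [ph ph4] := omega_tv C a (a + b); rewrite transv_move // => e.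
by exists ph => //; move: e; rewrite !pauli_1qubit.
Qed.

(** A tensor product of single-qubit moves is a local Clifford unitary taking one Pauli to the other
    up to phase, and averages are invariant under translation by it. *)
Lemma zprob_same_supp (a b : P) : [forall k, (b k == 0) == (a k == 0)] ->
  zprob G a = zprob G b.
Proof.
move=> /forallP ab.
have /fin_all_exists2[u uC uE] (k : 'I_n) : exists2 u : 'M[C]_(2 ^ 1), clifford u &
    exists2 ph : C, ph ^+ 4 = 1 & omega u (pauli1 C (b k)) = ph *: pauli1 C (a k).
  by apply: pauli1_move; have /eqP-> := ab k.
have [ph ph4 phE] := fin_all_exists2 uE.
pose v (k : nat) : 'M[C]_2 := if insub k is Some k' then u k' else 1%:M.
have vE (k : 'I_n) : v k = u k by rewrite /v valK.
have vL : local_clifford (tensn n v).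
  by exists v; split=> // k lt_kn; rewrite (vE (Ordinal lt_kn)).
have vb : omega (tensn n v) (s b) = (\prod_k ph k) *: s a.
  rewrite /omega adj_tensn !tensn_mul; apply: tensnZ => k.
  by rewrite -!/(pauli_seq _ _ _) !pauli_seqE vE; exact: phE.
rewrite /zprob -[RHS](avg_translate (V := tensn n v) G_unif).
- apply: eq_avg => g _; rewrite (zimgM _ _ vb) //.
  by apply/prodf_neq0 => k _; exact: phase_neq0.
- by case: (local_cliffordC vL).
- by move=> U /local_cliffordM; apply.
- by move=> U /local_cliffordM; apply; exact: local_clifford_adj.
- by move=> g h gh; rewrite (zimg_same _ gh).
Qed.

Lemma expr_psupp (a : P) : 3 ^+ psupp a = \prod_k (if a k == 0 then 1 else 3) :> C.
Proof.
rewrite /psupp -prodr_const big_mkcond; apply: eq_bigr => k _.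
by rewrite inE if_neg.
Qed.

Lemma zprob_local (a : P) : zprob G a = (3 ^+ psupp a)^-1.
Proof.
(* Weights whose product is the indicator that a label has the support of [a]. *)
pose al k : C := (a k == 0)%:R; pose be k : C := (a k != 0)%:R.
have wE (b : P) : \prod_k (if b k == 0 then al k else be k) =
    [forall k, (b k == 0) == (a k == 0)]%:R.
  rewrite -prodr_bool; apply: eq_bigr => k _; rewrite /al /be.
  by case: (b k == 0); case: (a k == 0).
(* Exactly one Pauli with the support of [a] becomes diagonal under each [g]. *)
have one : \sum_(b : P) [forall k, (b k == 0) == (a k == 0)]%:R * zprob G b = 1.
  under eq_bigr do rewrite -avgZ.
  rewrite -avg_sum -[RHS](avg_const _ G0); apply: eq_avg => g /GL gL.
  under eq_bigr do rewrite -wE.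
  rewrite local_zimg_sum // big1 // => k _; rewrite /al /be.
  by case: (a k == 0); rewrite ?addr0 ?add0r.
have : (\sum_(b : P) [forall k, (b k == 0) == (a k == 0)]%:R) * zprob G a = 1.
  rewrite -[RHS]one mulr_suml; apply: eq_bigr => b _.
  by case: (boolP [forall k, _]) => [/zprob_same_supp->|]; rewrite ?mul0r.
(* There are [3 ^ psupp a] labels with that support, three nonzero choices for each qubit in it. *)
under eq_bigr do rewrite -wE.
rewrite -(bigA_distr_bigA (fun k (p : 'I_2 * 'I_2) => if p == 0 then al k else be k)).
rewrite (eq_bigr (fun k => if a k == 0 then 1 else 3)) -?expr_psupp.
  by move=> /(canRL (mulKf _)) ->; rewrite ?mulr1 // expf_neq0 // pnatr_eq0.
move=> k _; rewrite (bigD1 (0 : 'I_2 * 'I_2)) //= (eq_bigr (fun=> be k)).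
  rewrite sumr_const cardC1 card_prod !card_ord /al /be.
  by case: (a k == 0) => /=; rewrite ?mul0rn ?addr0 ?add0r.
by move=> p /negPf->.
Qed.

Let zprob_neq0 a : zprob G a != 0.
Proof. by rewrite zprob_local invr_eq0 expf_neq0 // pnatr_eq0. Qed.

Variables (Lam : 'M[C]_d -> 'M[C]_d -> 'M[C]_d) (rho : 'M[C]_d).
Hypothesis Lam_channel : forall g, g \in G -> is_channel (Lam g).
Hypothesis rho_density : density rho.

Lemma local_variance_le (O : 'M[C]_d) (B : 'M[C]_d -> C) :
    (forall g x, g \in G -> `|ohat G O g x| ^+ 2 <= B g) ->
  variance G Lam rho O <= avg G B.
Proof.
move=> le_B; apply: (variance_le G0 _ Lam_channel rho_density (t := 0)) =>
  [g /GC[]//|g x gG].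
by rewrite subr0 le_B.
Qed.

(** Only one term of the estimator survives, of modulus $3^{|a|}$ when $\sigma_a$ becomes diagonal
    and 0 otherwise; the second moment is $9^{|a|} s_a = 3^{|a|}$. *)
Theorem local_variance_pauli a : variance G Lam rho (s a) <= (3 ^ psupp a)%N%:R.
Proof.
apply: (@le_trans _ _ (avg G (fun g => (3 ^+ psupp a) ^+ 2 * (zimg g a)%:R))).
  apply: local_variance_le => g x gG; have gC := GC gG.
  rewrite ohat_pauli // (bigD1 a) //= big1 => [|b /negPf ba]; last first.
    by rewrite hs_pauli ba mulr0 rmorph0 mulr0.
  rewrite addr0 hs_pauli eqxx mulr1 rmorph_nat mulrC mulfK ?dim_neq0 //.
  rewrite zprob_local invrK normrM norm_conjC norm_omega_pauli // exprMn.
  rewrite ger0_norm ?exprn_ge0 ?ler0n // ler_wpM2l ?exprn_ge0 ?ler0n //.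
  by case: zimg; rewrite ?expr1n ?expr0n.
rewrite avgZ -/(zprob G a) zprob_local expr2 mulfK ?natrX //.
by rewrite expf_neq0 // pnatr_eq0.
Qed.

(** Weighted Cauchy-Schwarz through Lagrange's identity: the difference is half of $\sum_{i,j} w_i
    w_j (t_i-t_j)^2$. *)
Lemma sum_sqr_le (I : finType) (w t : I -> C) :
    (forall i, 0 <= w i) -> (forall i, 0 <= t i) ->
  (\sum_i w i * t i) ^+ 2 <= (\sum_i w i) * (\sum_i w i * t i ^+ 2).
Proof.
move=> w0 t0; rewrite -subr_ge0.
have -> : (\sum_i w i) * (\sum_i w i * t i ^+ 2) - (\sum_i w i * t i) ^+ 2 =
    2^-1 * \sum_i \sum_j w i * w j * (t i - t j) ^+ 2.
  have e i j : w i * w j * (t i - t j) ^+ 2 =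
      w j * (w i * t i ^+ 2) + (w i * (w j * t j ^+ 2) - 2 * (w i * t i * (w j * t j))).
    by ring.
  under [in RHS]eq_bigr do under eq_bigr do rewrite e.
  under [in RHS]eq_bigr do rewrite big_split sumrB /= -mulr_suml -!mulr_sumr.
  rewrite big_split sumrB /= -mulr_suml -mulr_sumr -mulr_sumr -mulr_suml.
  apply: (mulfI (_ : 2 != 0)); rewrite ?pnatr_eq0 // mulVKf ?pnatr_eq0 //.
  ring.
rewrite mulr_ge0 ?invr_ge0 ?ler0n //; apply: sumr_ge0 => i _; apply: sumr_ge0 => j _.
apply: mulr_ge0; first exact: mulr_ge0.
by rewrite real_exprn_even_ge0 // rpredB // ger0_real.
Qed.

(* The weights [be k] in place of 3 serve to discard the Paulis that do not
   occur in [O]: take [be k = 0] off the support of [O]. *)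
Lemma local_variance_weighted (O : 'M[C]_d) (be : 'I_n -> C) :
    (forall k, 0 <= be k) ->
    (forall a, hs (s a) O != 0 -> \prod_k (if a k == 0 then 1 else be k) = 3 ^+
      psupp a) ->
  variance G Lam rho O <= d%:R^-1 * (\prod_k (1 + be k)) * hs O O.
Proof.
move=> be_ge0 beP; pose W (a : P) : C := \prod_k (if a k == 0 then 1 else be k).
have W_ge0 a : 0 <= W a by apply: prodr_ge0 => k _; case: ifP; rewrite ?ler01.
pose c (a : P) : C := `|hs (s a) O|.
pose B (g : 'M[C]_d) : C := d%:R^-1 ^+ 2 *
  ((\prod_k (1 + be k)) * \sum_(a : P) W a * c a ^+ 2 * (zimg g a)%:R).
apply: (@le_trans _ _ (avg G B)).
  apply: local_variance_le => g x gG; have gC := GC gG.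
  rewrite ohat_pauli //.
  have le1 : `|d%:R^-1 * \sum_a (zprob G a)^-1 * (omega g (s a) x x)^* * (hs (s a) O)^*|
      <= d%:R^-1 * \sum_(a : P) W a * (zimg g a)%:R * c a.
    apply: le_trans; first exact: norm_pauli_estimate.
    rewrite le_eqVlt; apply/orP; left; apply/eqP; congr (_ * _); apply: eq_bigr => a _.
    rewrite zprob_local invrK /c; have [->|nz] := eqVneq (hs (s a) O) 0.
      by rewrite normr0 !mulr0.
    by rewrite -beP.
  apply: (@le_trans _ _ ((d%:R^-1 * \sum_(a : P) W a * (zimg g a)%:R * c a) ^+ 2)).
    by rewrite ler_sqr ?nnegrE ?normr_ge0 // (le_trans _ le1).
  rewrite exprMn ler_wpM2l ?exprn_ge0 ?invr_ge0 ?ler0n //.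
  (* Cauchy-Schwarz with weights [W a * (zimg g a)%:R], whose sum is the same for every [g] by
     [local_zimg_sum]. *)
  apply: le_trans; first apply: sum_sqr_le => a; rewrite ?mulr_ge0 ?ler0n ?normr_ge0 //.
  rewrite (local_zimg_sum (fun=> 1) be (GL gG)).
  rewrite le_eqVlt; apply/orP; left; apply/eqP; congr (_ * _); apply: eq_bigr => a _.
  by rewrite mulrAC.
rewrite /B !avgZ avg_sum.
rewrite (eq_bigr (fun a : P => c a ^+ 2)) => [|a _].
  rewrite pauli_parseval le_eqVlt; apply/orP; left; apply/eqP.
  by field; rewrite dim_neq0.
(* The average of the indicator, $3^{-|a|}$, cancels [W a] wherever the coefficient of [O] is
   nonzero. *)
rewrite avgZ -/(zprob G a) zprob_local /c; have [->|nz] := eqVneq (hs (s a) O) 0.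
  by rewrite normr0 expr0n mulr0 mul0r.
by rewrite /W beP // mulrAC mulfV ?mul1r // expf_neq0 // pnatr_eq0.
Qed.

End LocalVariance.

(** * Observables acting on the first k qubits *)

Section TensorObservable.
Variable C : numClosedFieldType.

Lemma hs_castmx p q (e : p = q) (A B : 'M[C]_p) :
  hs (castmx (e, e) A) (castmx (e, e) B) = hs A B.
Proof. by case: q / e; rewrite !castmx_id. Qed.

Lemma hs_tens p q (A A' : 'M[C]_p) (B B' : 'M[C]_q) :
  hs (A *t B) (A' *t B') = hs A A' * hs B B'.
Proof. by rewrite /hs adj_tens tensmx_mul mxtrace_tens. Qed.

(** The overlap factorizes over the qubits, and a nontrivial Pauli paired with the identity on qubit
    [k + j] has trace 0. *)
Lemma hs_pauli_tens1 k m (a : {ffun 'I_(k + m) -> 'I_2 * 'I_2}) (A : 'M[C]_(2 ^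
  k)) (j : 'I_m) :
  a (rshift k j) != 0 ->
  hs (pauli C a) (castmx (esym (expnD 2 k m), esym (expnD 2 k m)) (A *t 1%:M)) = 0.
Proof.
move=> aj; rewrite /pauli tensn_split hs_castmx hs_tens.
rewrite [X in _ * X](_ : _ = 0) ?mulr0 // /hs mulmx1 adj_tensn mxtrace_tensn.
rewrite (bigD1 j) //= -/(pauli_seq C a (k + j)) -[(k + j)%N]/(nat_of_ord (rshift k j)).
by rewrite pauli_seqE adj_pauli1 mxtrace_pauli1 (negPf aj) mulr0 mul0r.
Qed.

End TensorObservable.

(** * Spectral norm *)

Section SpectralNorm.
Variable R : realType.
Local Notation C := R[i].

Lemma adj_mul_self m (v : 'cV[C]_m) : (adj v *m v) 0 0 = \sum_i `|v i 0| ^+ 2.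
Proof. by rewrite mxE; apply: eq_bigr => i _; rewrite !mxE normCK mulrC. Qed.

Lemma vnormE m (v : 'cV[C]_m) : (vnorm v ^+ 2)%:C%C = \sum_i `|v i 0| ^+ 2.
Proof.
have v_ge0 : 0 <= \sum_i `|v i 0| ^+ 2 by apply: sumr_ge0 => i _; rewrite exprn_ge0.
rewrite /vnorm adj_mul_self sqr_sqrtr ?RRe_real ?ger0_real //.
by move: v_ge0; rewrite lecE => /andP[].
Qed.

Lemma vnorm_ge0 m (v : 'cV[C]_m) : 0 <= vnorm v.
Proof. exact: sqrtr_ge0. Qed.

Lemma vnorm_le_specnorm m (A : 'M[C]_m) (v : 'cV[C]_m) :
  vnorm v <= 1 -> vnorm (A *m v) <= specnorm A.
Proof.
move=> v1; apply: ub_le_sup; last by exists v.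
(* [sup] is an upper bound only for a bounded set; a crude bound by absolute row sums suffices, as
   coordinates of vectors in the unit ball have modulus at most 1. *)
pose b : C := \sum_i (\sum_j `|A i j|) ^+ 2.
have b_ge0 : 0 <= b by apply: sumr_ge0 => i _; rewrite exprn_ge0 ?sumr_ge0.
exists (Num.sqrt (complex.Re b)) => _ [w w1 <-].
rewrite -(@ler_pXn2r _ 2) ?nnegrE ?sqrtr_ge0 // [leRHS]sqr_sqrtr; last first.
  by move: b_ge0; rewrite lecE => /andP[].
rewrite -lecR vnormE RRe_real ?ger0_real //; apply: ler_sum => i _.
rewrite ler_sqr ?nnegrE ?sumr_ge0 // mxE.
apply: (le_trans (ler_norm_sum _ _ _)); apply: ler_sum => j _.
rewrite normrM ler_piMr // -(@ler_pXn2r _ 2) ?nnegrE // expr1n.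
have : (vnorm w ^+ 2)%:C%C <= 1 :> C.
  by rewrite -[1]/(1%:C%C) lecR expr_le1 // vnorm_ge0.
rewrite vnormE; apply: le_trans; rewrite (bigD1 j) //= lerDl.
by apply: sumr_ge0 => l _; rewrite exprn_ge0.
Qed.

(** The squared Hilbert-Schmidt norm is the sum of the squared norms of the [m] columns, each the
    image of a unit basis vector. *)
Lemma hs_le_specnorm m (A : 'M[C]_m) :
  hs A A <= (m%:R * specnorm A ^+ 2)%:C%C.
Proof.
rewrite hsE exchange_big rmorphM rmorph_nat /= mulr_natl.
rewrite [leRHS](_ : _ = \sum_(j < m) (specnorm A ^+ 2)%:C%C); last first.
  by rewrite sumr_const card_ord.
apply: ler_sum => j _.
pose e : 'cV[C]_m := delta_mx j 0.
have -> : \sum_i (A i j)^* * A i j = (vnorm (A *m e) ^+ 2)%:C%C.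
  by rewrite vnormE -colE; apply: eq_bigr => i _; rewrite mxE normCK mulrC.
have e1 : vnorm e <= 1.
  rewrite -(@ler_pXn2r _ 2) ?nnegrE ?vnorm_ge0 // expr1n -lecR vnormE.
  rewrite (bigD1 j) //= big1 => [|i /negPf ij];
    first by rewrite mxE !eqxx normr1 expr1n addr0.
  by rewrite mxE ij normr0 expr0n.
rewrite lecR ler_pXn2r ?nnegrE ?vnorm_ge0 ?(le_trans (vnorm_ge0 _)
  (vnorm_le_specnorm _ e1)) //.
exact: vnorm_le_specnorm.
Qed.

End SpectralNorm.

Theorem theorem2 :
  (* (i) global Clifford group Cl_n *)
  (forall (R : realType) (n : nat) (G : seq 'M[R[i]]_(2 ^ n))
     (Lam : 'M[R[i]]_(2 ^ n) -> 'M[R[i]]_(2 ^ n) -> 'M[R[i]]_(2 ^ n))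
     (rho O : 'M[R[i]]_(2 ^ n)),
     uniform_on (@clifford _ n) G ->
     (forall g, g \in G -> is_channel (Lam g)) ->
     density rho -> is_hermitian O ->
     variance G Lam rho O <=
       (2 * (2 ^ n + 1))%N%:R / (2 ^ n + 2)%N%:R * stnorm (traceless O) ^+ 2
       + (2 ^ n + 1)%N%:R / (2 ^ n)%N%:R * hs (traceless O) (traceless O)) /\
  (* (ii) local Clifford group Cl_1^{x n}, k-local observables, n = k + m *)
  (forall (R : realType) (k m : nat) (G : seq 'M[R[i]]_(2 ^ (k + m)))
     (Lam : 'M[R[i]]_(2 ^ (k + m)) -> 'M[R[i]]_(2 ^ (k + m)) -> 'M[R[i]]_(2 ^ (k + m)))
     (rho O : 'M[R[i]]_(2 ^ (k + m))) (Oloc : 'M[R[i]]_(2 ^ k)),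
     uniform_on (@local_clifford _ (k + m)) G ->
     (forall g, g \in G -> is_channel (Lam g)) ->
     density rho -> is_hermitian O ->
     O = castmx (esym (expnD 2 k m), esym (expnD 2 k m))
           (Oloc *t (1%:M : 'M[R[i]]_(2 ^ m))) ->
     variance G Lam rho O <= ((4 ^ k)%N%:R * specnorm Oloc ^+ 2)%:C%C) /\
  (* (ii) local Clifford group, Pauli observables *)
  (forall (R : realType) (n : nat) (G : seq 'M[R[i]]_(2 ^ n))
     (Lam : 'M[R[i]]_(2 ^ n) -> 'M[R[i]]_(2 ^ n) -> 'M[R[i]]_(2 ^ n))
     (rho : 'M[R[i]]_(2 ^ n)) (a : {ffun 'I_n -> 'I_2 * 'I_2}),
     uniform_on (@local_clifford _ n) G ->
     (forall g, g \in G -> is_channel (Lam g)) ->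
     density rho ->
     variance G Lam rho (@pauli R[i] n a) <= (3 ^ psupp a)%N%:R).
Proof.
split=> [R n G Lam rho O G_unif Lam_channel rho_density _|].
  exact: global_variance.
split=> [R k m G Lam rho O Oloc G_unif Lam_channel rho_density _ ->|]; last first.
  by move=> R n G Lam rho a G_unif Lam_channel rho_density; exact: local_variance_pauli.
(* Weight 3 on the first [k] qubits and 0 on the rest, where [O] has no Pauli component; the product
   of the [1 + be i] is then $4^k$. *)
pose be (i : 'I_(k + m)) : R[i] := if (i < k)%N then 3 else 0.
apply: le_trans.
  apply: (local_variance_weighted G_unif Lam_channel rho_density (be := be)) =>
    [i|a nz].
    by rewrite /be; case: ifP; rewrite ?ler0n.
  rewrite expr_psupp; apply: eq_bigr => i _; rewrite /be.
  case: eqVneq => // ai; case: (split_ordP i) => j ij //.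
  by rewrite ij in ai; rewrite (hs_pauli_tens1 _ ai) eqxx in nz.
rewrite hs_castmx hs_tens /hs -/(hs _ _) adj_scalar1 mulmx1 mxtrace1.
have -> : \prod_i (1 + be i) = (4 ^ k)%:R.
  rewrite big_split_ord /= [X in _ * X]big1 => [|j _]; last first.
    by rewrite /be /= ltnNge leq_addr addr0.
  rewrite mulr1 (eq_bigr (fun=> 4)) ?prodr_const ?card_ord ?natrX // => j _.
  by rewrite /be /= ltn_ord -natr1; ring.
have nz (p : nat) : (2 ^ p)%:R != 0 :> R[i] by rewrite pnatr_eq0 -lt0n expn_gt0.
(* The identity on the last [m] qubits contributes $2^m$ to [hs O O], which cancels against the
   dimension factor. *)
rewrite expnD natrM invfM.
have -> : (2 ^ k)%:R^-1 / (2 ^ m)%:R * (4 ^ k)%:R * (hs Oloc Oloc * (2 ^ m)%:R) =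
    (4 ^ k)%:R * ((2 ^ k)%:R^-1 * hs Oloc Oloc) :> R[i] by field; rewrite !nz.
rewrite rmorphM rmorph_nat ler_wpM2l ?ler0n // ler_pdivrMl ?ltr0n ?expn_gt0 //.
by have := hs_le_specnorm Oloc; rewrite rmorphM rmorph_nat.
Qed.
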